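(* Fix $n\in\mathbb{N}$ and for each $1\le i\le n$ let $(X_i,d_i,\mu_i)$ be a metric space equipped with a $\sigma$-finite Borel regular measure $\mu_i$. Let $X=\prod_{i=1}^n X_i$ with metric $d(\mathbf{x},\mathbf{y})=\max_{1\le i\le n} d_i(x_i,y_i)$ and product measure $\mu=\mu_1\times\dots\times\mu_n$. Let $\Phi=(\phi_1,\dots,\phi_n)$ be an $n$-tuple of non-negative functions on $\mathbb{N}$ with $\phi_i(\alpha)\to0$ as $\alpha\to\infty$ for each $i$, and let $\mathcal{R}=(R_\alpha)_{\alpha\in\mathbb{N}}$ be a sequence of subsets of $X$. Assume at least one of the following holds: (i) $\mu$ is doubling, and $R_\alpha\subset\operatorname{supp}\mu$ for each $\alpha\in\mathbb{N}$; (ii) $\phi_1=\dots=\phi_n$, and for any $0<\delta<\rho$ there exists a constant $c(\delta,\rho)>0$ such that for each sufficiently large $\alpha\in\mathbb{N}$ and every point $\mathbf{x}\in R_\alpha$, $$\mu\big(\{\mathbf{y}\in X: d_i(x_i,y_i)<\delta\phi_i(\alpha)\ \forall i\}\big)\ \ge\ c(\delta,\rho)\,\mu\big(\{\mathbf{y}\in X: d_i(x_i,y_i)<\rho\phi_i(\alpha)\ \forall i\}\big).$$ Then $\mu(\mathbf{Bad}_{\mathcal{R}}(\Phi))=0$.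
   Context: For $c>0$ write $c\Phi=(c\phi_1,\dots,c\phi_n)$. For $\alpha\in\mathbb{N}$ let $\Delta(R_\alpha,\Phi)=\{\mathbf{x}\in X:\exists\,\mathbf{a}\in R_\alpha\text{ with } d_i(a_i,x_i)<\phi_i(\alpha)\ \forall\,1\le i\le n\}$. Let $\mathcal{W}_{\mathcal{R}}(\Phi)=\limsup_{\alpha\to\infty}\Delta(R_\alpha,\Phi)$ (points lying in $\Delta(R_\alpha,\Phi)$ for infinitely many $\alpha$), and $\mathbf{Bad}_{\mathcal{R}}(\Phi)=\mathcal{W}_{\mathcal{R}}(\Phi)\setminus\bigcap_{k\in\mathbb{N}}\mathcal{W}_{\mathcal{R}}(\tfrac1k\Phi)$. A measure $\mu$ is doubling if there exist $\lambda>0$ and $r_0>0$ such that for every ball $B(x,r)$ with $x\in\operatorname{supp}\mu$ and $0<r<r_0$ one has $\mu(B(x,2r))\le\lambda\,\mu(B(x,r))$.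
   Formalization: The measure μ is additionally assumed locally finite (each point of X has a ball of finite measure), and in case (ii) the complement of supp μ is assumed μ-null (automatic for separable X_i); without these the claim fails, respectively is not provable. *)

(* Defs.v *)
(* Measures are those of geometric measure theory, that is, outer measures
   defined on every subset; the measurable sets are Caratheodory's. *)
From HB Require Import structures.
From mathcomp Require Import all_boot all_order all_algebra.
From mathcomp Require Import all_classical all_reals all_analysis.
Set Implicit Arguments.
Unset Strict Implicit.
Unset Printing Implicit Defensive.
Import Order.TTheory GRing.Theory Num.Theory.
Import numFieldNormedType.Exports.
Local Open Scope classical_set_scope.
Local Open Scope ring_scope.

Definition borel_regular (R : realType) (T : topologicalType)
    (mu : {outer_measure set T -> \bar R}) : Prop :=
  (forall B : set T, <<s open >> B -> mu.-caratheodory B) /\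
  (forall A : set T, exists B : set T,
     [/\ <<s open >> B, A `<=` B & mu B = mu A]).

(* The library's [sigma_finite] on [caratheodory_type mu], which is available
   only for pointed types, written out. *)
Definition sigma_finite_outer (R : realType) (T : Type)
    (mu : {outer_measure set T -> \bar R}) : Prop :=
  exists2 F : nat -> set T, [set: T] = \bigcup_k F k &
    forall k, mu.-caratheodory (F k) /\ (mu (F k) < +oo)%E.

(* For an arbitrary distance, because the product of the [X i] below carries
   no canonical [metricType] structure. *)
Definition dball (R : realType) (T : Type) (d : T -> T -> R)
    (x : T) (r : R) : set T := [set y | d x y < r].

Definition msupp (R : realType) (T : Type) (d : T -> T -> R)
    (mu : set T -> \bar R) : set T :=
  [set x | forall r : R, 0 < r -> (0 < mu (dball d x r))%E].

Definition locally_finite_measure (R : realType) (T : Type) (d : T -> T -> R)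
    (mu : set T -> \bar R) : Prop :=
  forall x : T, exists2 r : R, 0 < r & (mu (dball d x r) < +oo)%E.

Definition doubling (R : realType) (T : Type) (d : T -> T -> R)
    (mu : set T -> \bar R) : Prop :=
  exists lambda r0 : R, [/\ 0 < lambda, 0 < r0 &
    forall (x : T) (r : R), msupp d mu x -> 0 < r -> r < r0 ->
      (mu (dball d x (2 * r)) <= lambda%:E * mu (dball d x r))%E].

(* The distances are nonnegative, so starting the maximum at 0 is harmless. *)
Definition dist_max (R : realType) (n : nat) (X : 'I_n -> metricType R)
    (x y : forall i, X i) : R :=
  \big[Num.max/0]_(i < n) mdist (x i) (y i).

(* The product measure mu_1 x ... x mu_n as an outer measure: the infimum of
   the total mass of the countable covers by boxes with measurable sides
   (with 0 * +oo = 0, as in [\bar R]). *)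
Definition prod_measure (R : realType) (n : nat) (X : 'I_n -> metricType R)
    (mu : forall i, {outer_measure set (X i) -> \bar R})
    (A : set (forall i, X i)) : \bar R :=
  ereal_inf [set (\sum_(0 <= k <oo) \prod_(i < n) mu i (F k i))%E
    | F in [set F : nat -> forall i, set (X i) |
        (forall k i, (mu i).-caratheodory (F k i)) /\
        A `<=` \bigcup_k [set x | forall i, F k i (x i)]]].

Definition rect (R : realType) (n : nat) (X : 'I_n -> metricType R)
    (a : forall i, X i) (r : 'I_n -> R) : set (forall i, X i) :=
  [set x | forall i, mdist (a i) (x i) < r i].

Definition Delta (R : realType) (n : nat) (X : 'I_n -> metricType R)
    (Rs : nat -> set (forall i, X i)) (phi : 'I_n -> nat -> R) (alpha : nat) :
    set (forall i, X i) :=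
  [set x | exists2 a, Rs alpha a & rect a (phi ^~ alpha) x].

Definition Wset (R : realType) (n : nat) (X : 'I_n -> metricType R)
    (Rs : nat -> set (forall i, X i)) (phi : 'I_n -> nat -> R) :
    set (forall i, X i) :=
  lim_sup_set (Delta Rs phi).

(* k ranges over the positive integers, written k.+1. *)
Definition Bad (R : realType) (n : nat) (X : 'I_n -> metricType R)
    (Rs : nat -> set (forall i, X i)) (phi : 'I_n -> nat -> R) :
    set (forall i, X i) :=
  Wset Rs phi `\`
  \bigcap_(k : nat) Wset Rs (fun i alpha => k.+1%:R^-1 * phi i alpha).

(* Main.v *)
(* Let E be the set of points of W(Phi) in no Delta(R_a, k Phi) with a >= l,
   where 0 < k <= 1; Bad(Phi) is a countable union of such sets.

   When the phi_i coincide, E is a null set by a Vitali covering argument: points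
   of E lie in arbitrarily small balls B(a, r) whose concentric balls B(a, k r)
   avoid E and carry a fixed proportion of the mass of B(a, 5 r). A disjoint
   subfamily contained in an open U approximating E from outside gives
   mu(U) >= (1 + c) mu(E), hence mu(E) = 0.

   When mu is doubling, the rectangles have unbounded eccentricity and no such
   covering lemma is available, so the sides are shrunk one at a time. For a single
   side j, the slices of the exceptional set in direction j are null by the same
   argument in X_j, whose measure inherits the doubling property from mu, and a
   Fubini argument concludes. The factors need not be separable, but the support
   of mu is Lindelof because mu is sigma-finite; this makes the relevant sets
   measurable. *)
Require Import Defs.
From HB Require Import structures.
From mathcomp Require Import all_boot all_order all_algebra.
From mathcomp Require Import all_classical all_reals all_analysis.
From mathcomp Require Import lra measurable_realfun.
Import Order.TTheory GRing.Theory Num.Theory.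
Import numFieldNormedType.Exports.
Local Open Scope classical_set_scope.
Local Open Scope ring_scope.
Set Implicit Arguments.
Unset Strict Implicit.
Unset Printing Implicit Defensive.

(** * Vitali coverings and null sets for a bare distance function *)

Definition is_dist (R : realType) (T : Type) (d : T -> T -> R) : Prop :=
  [/\ forall x, d x x = 0, forall x y, d x y = d y x &
      forall x y z, d x z <= d x y + d y z].

(* A maximal disjoint subfamily E such that every ball meeting a member of E
   meets one with at least half its radius; maximality makes every ball meet E,
   since a nearly largest ball missing E could be added to it. *)
Lemma vitali_disjoint_subfamily (R : realType) (T I : Type) (d : T -> T -> R)
    (D : set I) (c : I -> T) (r : I -> R) (M : R) :
  is_dist d -> (forall i, D i -> 0 < r i <= M) ->
  exists E : set I, [/\ E `<=` D, trivIset E (fun i => dball d (c i) (r i)) &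
    forall i, D i -> exists2 j, E j &
      dball d (c i) (r i) `<=` dball d (c j) (5 * r j)].
Proof.
move=> [dxx dsym dtri] rM; pose B i := dball d (c i) (r i).
have Bself i : D i -> B i (c i).
  by move=> /rM /andP[r0 _]; rewrite /B /dball /= dxx.
pose good (E : set I) := [/\ E `<=` D, trivIset E B &
  forall i, D i -> (exists2 j, E j & B i `&` B j !=set0) ->
    exists2 k, E k & B i `&` B k !=set0 /\ r i <= 2 * r k].
have [F FP totF|E [[ED tE hE] maxE]] := @Zorn_bigcup _ good.
  split.
  - by move=> i [A FA Ai]; have [+ _ _] := FP _ FA; exact.
  - move=> i j [A FA Ai] [A' FA' Aj].
    have [AA|AA] := totF _ _ FA FA'.
      by have [_ + _] := FP _ FA'; apply=> //; exact: AA.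
    by have [_ + _] := FP _ FA; apply=> //; exact: AA.
  - move=> i Di [j [A FA Aj] ij]; have [_ _ h] := FP _ FA.
    have [k Ak Bk] := h i Di (ex_intro2 _ _ j Aj ij).
    by exists k => //; exists A.
have meet i : D i -> exists2 j, E j & B i `&` B j !=set0.
  move=> Di; apply: contrapT => Ei.
  pose N := [set j | D j /\ ~ exists2 k, E k & B j `&` B k !=set0].
  have Ni : N i by [].
  have supN : has_sup (r @` N).
    split; first by exists (r i); exists i.
    by exists M => _ [j [Dj _] <-]; case/andP: (rM _ Dj).
  have ri : 0 < r i by case/andP: (rM _ Di).
  have s0 : 0 < sup (r @` N).
    by apply: lt_le_trans ri _; apply: ub_le_sup; [exact: supN.2|exists i].
  have e0 : 0 < sup (r @` N) / 2 by rewrite divr_gt0.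
  have [_ [i1 [Di1 Ei1] <-] hi1] := sup_adherent e0 supN.
  apply: (maxE (E `|` [set i1])).
    split; first by move=> x Ex; left.
    move=> EE; apply: Ei1; exists i1; first by apply: EE; right.
    by exists (c i1); split; exact: Bself.
  split.
  - by move=> j [/ED//|->].
  - move=> j k [Ej|->] [Ek|->] //.
    + exact: tE.
    + by move=> jk; exfalso; apply: Ei1; exists j => //; rewrite setIC.
    + by move=> jk; exfalso; apply: Ei1; exists k.
  - move=> j Dj [k Ek jk].
    have [Ej|Ej] := pselect (exists2 k, E k & B j `&` B k !=set0).
      by have [l El Bl] := hE _ Dj Ej; exists l => //; left.
    case: Ek => [Ek|ki1]; first by exfalso; apply: Ej; exists k.
    move: ki1 jk => -> jk; exists i1; first by right.
    split => //.
    have : r j <= sup (r @` N) by apply: ub_le_sup; [exact: supN.2|exists j].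
    by lra.
exists E; split => // i Di.
have [j Ej [[z [iz jz]] ij]] : exists2 j, E j & B i `&` B j !=set0 /\ r i <= 2 * r j.
  by apply: hE => //; exact: meet.
(* The factor 5 arises here: through the common point [z], a point of the ball [i] is at distance
   less than [r j + 2 * r i], hence less than [5 * r j], from [c j]. *)
exists j => // y; move: iz jz; rewrite /B /dball /= => iz jz iy.
have := dtri (c j) z y; have := dtri z (c i) y.
by rewrite (dsym z (c i)); lra.
Qed.

(** Since [U] has finite mass, only finitely many disjoint sets can have a trace of mass at least
    [1/(m+1)] on it, and every index falls under some [m]. *)
Lemma countable_disjoint_gt0 (R : realType) (T I : Type)
    (mu : {outer_measure set T -> \bar R}) (U : set T) (B : I -> set T)
    (E : set I) : (mu U < +oo)%E ->
  (forall i, E i -> mu.-caratheodory (B i)) -> trivIset E B ->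
  (forall i, E i -> (0 < mu (U `&` B i))%E) -> countable E.
Proof.
move=> Uoo mB tB B0.
pose Em m := [set i | E i /\ (m.+1%:R^-1%:E <= mu (U `&` B i))%E].
have -> : E = \bigcup_m Em m.
  apply/seteqP; split=> [i Ei|i [m _ []]//].
  have [mi|] := ltP (mu (U `&` B i)) +oo%E; last first.
    by rewrite leye_eq => /eqP mi; exists 0%N => //; split => //; rewrite mi leey.
  have fi : mu (U `&` B i) \is a fin_num by rewrite ge0_fin_numE ?outer_measure_ge0.
  have := B0 _ Ei; rewrite -(fineK fi) lte_fin => gi.
  have [m _ /(_ m (leqnn m)) hm] := near_infty_natSinv_lt (PosNum gi).
  exists m => //; split; first exact: Ei.
  by rewrite -(fineK fi) lee_fin; exact: ltW hm.
apply: bigcup_countable => // m _; apply: finite_set_countable.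
(* An infinite [Em m] contains a sequence [f] of distinct indices, and its first [n] sets would give
   [n/(m+1) <= mu U] for all [n]. *)
apply: contrapT => /infiniteP/card_leP[g].
pose f n := val (g (SigSub (mem_set (Logic.I : setT n)))).
have fE n : Em m (f n) by apply: set_mem; exact: valP.
have finj : injective f.
  move=> x y /val_inj xy; have := @inj _ _ _ g _ _ _ _ xy.
  by rewrite !inE => /(_ Logic.I Logic.I) [].
have tA : trivIset setT (B \o f).
  by move=> i j _ _ ij; apply: finj; apply: tB ij; exact: (fE _).1.
have mA n : mu.-caratheodory ((B \o f) n) by apply: mB; exact: (fE _).1.
have fU : mu U \is a fin_num by rewrite ge0_fin_numE ?outer_measure_ge0.
have le n : n%:R * m.+1%:R^-1 <= fine (mu U).
  rewrite -lee_fin fineK//.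
  have -> : ((n%:R * m.+1%:R^-1 : R)%:E = \sum_(i < n) m.+1%:R^-1%:E)%E.
    by rewrite sumEFin sumr_const card_ord mulr_natl.
  apply: (@le_trans _ _ (mu (U `&` \big[setU/set0]_(i < n) (B \o f) i))).
    rewrite (caratheodory_additive mA tA); apply: lee_sum => i _.
    exact: (fE _).2.
  by apply: le_outer_measure; exact: subIsetl.
have := le (Num.truncn (fine (mu U) * m.+1%:R)).+1.
by rewrite ler_pdivrMr// leNgt truncnS_gt.
Qed.

Lemma is_dist_ge0 (R : realType) (T : Type) (d : T -> T -> R) (x y : T) :
  is_dist d -> 0 <= d x y.
Proof.
by move=> [dxx dsym /(_ x y x)]; rewrite dxx (dsym y x); lra.
Qed.

(** An injection of a countable index set into [nat] turns a union over it into a union over fibres;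
    as each fibre is a singleton or empty, no default index has to be chosen. *)
Lemma fiber_set1_or_set0 (I : Type) (C : set I) (f : I -> nat) (n : nat) :
  {in C &, injective f} ->
  (exists2 i, C i & [set j | C j /\ f j = n] = [set i]) \/
  [set j | C j /\ f j = n] = set0.
Proof.
move=> finj; have [[i [Ci fi]]|h] := pselect (exists i, C i /\ f i = n).
  left; exists i => //; apply/seteqP; split=> [j [Cj fj]|_ ->] //=.
  by apply: finj; rewrite ?inE// fi.
by right; rewrite -subset0 => i ?; apply: h; exists i.
Qed.

Lemma bigcup_fiber (I T : Type) (C : set I) (f : I -> nat) (F : I -> set T) :
  \bigcup_(i in C) F i = \bigcup_n \bigcup_(i in [set j | C j /\ f j = n]) F i.
Proof.
apply/seteqP; split=> [x [i Ci Fx]|x [n _ [i [Ci _] Fx]]]; last by exists i.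
by exists (f i) => //; exists i.
Qed.

Lemma outer_measure_null_bigcup (R : realType) (T : Type)
    (mu : {outer_measure set T -> \bar R}) (F : nat -> set T) :
  (forall k, mu (F k) = 0%E) -> mu (\bigcup_k F k) = 0%E.
Proof.
move=> F0; apply/eqP; rewrite eq_le outer_measure_ge0 andbT.
apply: le_trans (outer_measure_sigma_subadditive mu F) _.
by rewrite eseries0.
Qed.

Lemma outer_measure_null_countable (R : realType) (T I : Type)
    (mu : {outer_measure set T -> \bar R}) (C : set I) (F : I -> set T) :
  countable C -> (forall i, C i -> mu (F i) = 0%E) ->
  mu (\bigcup_(i in C) F i) = 0%E.
Proof.
move=> /countable_injP[f finj] F0; rewrite (bigcup_fiber _ f).
apply: outer_measure_null_bigcup => n.
have [[i Ci ->]| ->] := fiber_set1_or_set0 n finj.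
  by rewrite bigcup_set1 F0.
by rewrite bigcup_set0 outer_measure0.
Qed.

(** The disjoint balls given by the Vitali lemma have positive mass because their centres lie in the
    support. Each ball meets some piece of finite mass in positive mass, and each piece is so met by
    countably many balls only. *)
Lemma lindelof_msupp (R : realType) (T : Type) (d : T -> T -> R)
    (mu : {outer_measure set T -> \bar R}) (A : set T) (r : T -> R) :
  is_dist d -> (forall x s, mu.-caratheodory (dball d x s)) ->
  sigma_finite_outer mu -> A `<=` msupp d mu -> (forall x, A x -> 0 < r x) ->
  exists C, [/\ countable C, C `<=` A &
    A `<=` \bigcup_(x in C) dball d x (r x)].
Proof.
move=> dd mB [F FT Ffin] Asupp r0.
(* The division by 5 anticipates the Vitali dilation, and the cap by 1 provides the bounded radii
   that it requires. *)
pose s x := Num.min (r x) 1 / 5.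
have s0 x : A x -> 0 < s x.
  by move=> /r0 rx; rewrite divr_gt0// lt_min rx ltr01.
have sr x : 5 * s x <= r x.
  by rewrite /s mulrCA divff// mulr1 ge_min lexx.
have s1 x : A x -> 0 < s x <= 1.
  move=> Ax; rewrite s0//=.
  have : Num.min (r x) 1 <= 1 by rewrite ge_min lexx orbT.
  by rewrite /s; lra.
have [E [EA tE cE]] := @vitali_disjoint_subfamily _ _ _ d A id s 1 dd s1.
exists E; split => //; last first.
  move=> x Ax; have [y Ey xy] := cE _ Ax.
  exists y => //; have : dball d x (s x) x.
    by rewrite /dball /=; case: dd => -> _ _; exact: s0.
  by move=> /xy; rewrite /dball /= => /lt_le_trans; apply.
have -> : E = \bigcup_k [set x | E x /\ (0 < mu (F k `&` dball d x (s x)))%E].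
  apply/seteqP; split=> [x Ex|x [k _ []]//].
  apply: contrapT => h.
  have : (0 < mu (dball d x (s x)))%E by apply: Asupp; [exact: EA|apply/s0/EA].
  suff -> : mu (dball d x (s x)) = 0%E by rewrite ltxx.
  rewrite -[dball _ _ _]setTI FT setI_bigcupl.
  apply: outer_measure_null_bigcup => k; apply/eqP.
  rewrite eq_le outer_measure_ge0 andbT leNgt; apply/negP => k0.
  by apply: h; exists k.
apply: bigcup_countable => // k _.
apply: (@countable_disjoint_gt0 _ _ _ mu (F k) (fun x => dball d x (s x))).
- exact: (Ffin k).2.
- by move=> x _; exact: mB.
- by move=> x y [Ex _] [Ey _]; exact: tE.
- by move=> x [].
Qed.

(** The middle clause replaces openness of [U]: it asks for a ball around the points of [A] only, in
    terms of [d] alone. *)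
Definition outer_approx (R : realType) (T : Type) (d : T -> T -> R)
    (mu : set T -> \bar R) (A : set T) : Prop :=
  forall e : R, 0 < e -> exists U, [/\ A `<=` U,
    forall x, A x -> exists2 s, 0 < s & dball d x s `<=` U &
    (mu U <= mu A + e%:E)%E].

(** A failure of Lebesgue density at [x]: tiny balls through [x], not necessarily centred there,
    have concentric holes of comparable mass. The dilation 5 is that of the Vitali lemma. *)
Definition avoided_nearby (R : realType) (T : Type) (d : T -> T -> R)
    (mu : set T -> \bar R) (k c : R) (D : set T) (x : T) : Prop :=
  forall s : R, 0 < s -> exists a r, [/\ d a x < r, r < s,
    (0 < mu (dball d a (k * r)))%E,
    (c%:E * mu (dball d a (5 * r)) <= mu (dball d a (k * r)))%E &
    dball d a (k * r) `&` D = set0].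

(** The holes of a disjoint subfamily lie in [U] outside [D], and their total mass is at least
    [c * mu D] because the fivefold dilates cover [D]. Hence [(1 + c) * mu D <= mu U], which a tight
    enough [U] contradicts. *)
Lemma vitali_null (R : realType) (T : Type) (d : T -> T -> R)
    (mu : {outer_measure set T -> \bar R}) (D : set T) (k c : R) :
  is_dist d -> (forall x s, mu.-caratheodory (dball d x s)) ->
  k <= 1 -> 0 < c -> (mu D < +oo)%E ->
  outer_approx d mu D -> (forall x, D x -> avoided_nearby d mu k c D x) ->
  mu D = 0%E.
Proof.
move=> dd mB k1 c0 Doo outer hD.
have [_ dsym dtri] := dd.
apply/eqP; rewrite eq_le outer_measure_ge0 andbT leNgt; apply/negP => D0.
have Dfin : mu D \is a fin_num by rewrite ge0_fin_numE ?outer_measure_ge0.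
move: D0; rewrite -(fineK Dfin) lte_fin; set m := fine (mu D) => m0.
(* Half of the surplus [c * m] is allowed as error, so that [m + c * m <= m + c * m / 2] fails. *)
have e0 : 0 < c * m / 2 by rewrite divr_gt0// mulr_gt0.
have [U [DU opU leU]] := outer _ e0.
pose J := [set p : T * R | [/\ 0 < p.2 <= 1, dball d p.1 p.2 `<=` U,
     (0 < mu (dball d p.1 (k * p.2)))%E,
     (c%:E * mu (dball d p.1 (5 * p.2)) <= mu (dball d p.1 (k * p.2)))%E &
     dball d p.1 (k * p.2) `&` D = set0]].
have J1 p : J p -> 0 < p.2 <= 1 by case.
have [E [EJ tE cE]] := @vitali_disjoint_subfamily _ _ _ d J fst snd 1 dd J1.
have sub p : J p -> dball d p.1 (k * p.2) `<=` dball d p.1 p.2.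
  move=> [/andP[p0 _] _ _ _ _] x; rewrite /dball /= => /lt_le_trans; apply.
  by rewrite ger_pMl.
have Uoo : (mu U < +oo)%E.
  by apply: le_lt_trans leU _; rewrite -(fineK Dfin) -EFinD ltry.
have tEk : trivIset E (fun p => dball d p.1 (k * p.2)).
  move=> p q Ep Eq [x [px qx]]; apply: tE => //.
  by exists x; split; apply: sub => //; exact: EJ.
have /countable_injP[f finj] : countable E.
  apply: (@countable_disjoint_gt0 _ _ _ mu U _ E Uoo _ tEk) => // p /EJ Jp.
  rewrite setIidr; first by case: Jp.
  by apply: subset_trans (sub _ Jp) _; case: Jp.
(* [A l n] is the ball of index [n] scaled by [l], or empty if [n] is no index. *)
pose A l n := \bigcup_(p in [set p | E p /\ f p = n]) dball d p.1 (l * p.2).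
have mA n : mu.-caratheodory (A k n).
  rewrite /A; have [[i Ci ->]| ->] := fiber_set1_or_set0 n finj.
    by rewrite bigcup_set1.
  by rewrite bigcup_set0; exact: caratheodory_measurable_set0.
have tA : trivIset setT (A k).
  move=> i j _ _ [x [[p [Ep <-] px] [q [Eq <-] qx]]]; congr f.
  by apply: tEk => //; exists x.
have AU n : A k n `<=` U.
  by move=> x [p [/EJ Jp _] /(sub _ Jp)]; case: Jp => _ + _ _ _; apply.
have AD n : A k n `&` D = set0.
  rewrite -subset0 => x [[p [/EJ Jp _] px] Dx].
  by have [_ _ _ _ <-] := Jp.
have DA : D `<=` \bigcup_n A 5 n.
  move=> x Dx; have [s s0 sU] := opU _ Dx.
  (* A ball of radius below [s / 2] through [x] stays within distance [s] of [x], hence in [U]. *)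
  have s20 : 0 < Num.min (s / 2) 1 by rewrite lt_min divr_gt0//= ltr01.
  have [a [r [axr rs ? ? ?]]] := hD _ Dx _ s20.
  move: rs; rewrite lt_min => /andP[rs r1].
  have Jar : J (a, r).
    split => //=; first by rewrite (ltW r1) andbT (le_lt_trans _ axr)// is_dist_ge0.
    move=> y; rewrite /dball /= => ay; apply: sU; rewrite /dball /=.
    by have := dtri x a y; rewrite (dsym x a); lra.
  have [q Eq aq] := cE _ Jar.
  by exists (f q) => //; exists q => //; apply: aq; rewrite /dball /=.
have cA n : (c%:E * mu (A 5%R n) <= mu (A k n))%E.
  rewrite /A; have [[i Ci ->]| ->] := fiber_set1_or_set0 n finj.
    by rewrite !bigcup_set1; case: (EJ _ Ci).
  by rewrite !bigcup_set0 outer_measure0 mule0.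
have : (c%:E * mu D + mu D <= mu U)%E.
  (* The set [U] is split along the union of the holes; the part outside them still contains [D]. *)
  apply: le_trans (caratheodory_lime_le mA tA U); apply: leeD.
    apply: (@le_trans _ _ (c%:E * \sum_(0 <= i <oo) mu (A 5%R i))%E).
      rewrite lee_pmul2l// ?lte_fin//.
      apply: le_trans (outer_measure_sigma_subadditive mu _).
      exact: le_outer_measure.
    rewrite -nneseriesZl//; last by move=> i _; exact: outer_measure_ge0.
    apply: lee_nneseries => [i _ _|i _].
      by rewrite mule_ge0 ?outer_measure_ge0// lee_fin ltW.
    by rewrite setIidr.
  apply: le_outer_measure => x Dx; split; first exact: DU.
  by move=> [n _ Ax]; have := AD n; rewrite -subset0 => /(_ x); apply.
move=> /le_trans /(_ leU).
by rewrite -(fineK Dfin) -!EFinM -!EFinD lee_fin; rewrite -/m; lra.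
Qed.

(** The constant, the finiteness and the approximation are only local; the Lindelof property of the
    support leaves countably many local pieces of [D], each of them null. *)
Lemma vitali_null_local (R : realType) (T : Type) (d : T -> T -> R)
    (mu : {outer_measure set T -> \bar R}) (D : set T) (k : R) :
  is_dist d -> (forall x s, mu.-caratheodory (dball d x s)) ->
  sigma_finite_outer mu -> k <= 1 -> D `<=` msupp d mu ->
  (forall x, D x -> exists s c, [/\ 0 < s, 0 < c, (mu (dball d x s) < +oo)%E,
    forall A, A `<=` dball d x s -> outer_approx d mu A &
    forall y, D y -> dball d x s y -> avoided_nearby d mu k c D y]) ->
  mu D = 0%E.
Proof.
move=> dd mB sf k1 Dsupp hD.
pose s x := if pselect (D x) is left Dx then projT1 (cid (hD x Dx)) else 1.
have hs x : D x -> exists c, [/\ 0 < s x, 0 < c, (mu (dball d x (s x)) < +oo)%E,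
    forall A, A `<=` dball d x (s x) -> outer_approx d mu A &
    forall y, D y -> dball d x (s x) y -> avoided_nearby d mu k c D y].
  by move=> Dx; rewrite /s; case: pselect => // Dx'; case: cid.
have s0 x : D x -> 0 < s x by move=> /hs[c []].
have [C [cC CD DC]] := lindelof_msupp dd mB sf Dsupp s0.
have -> : D = \bigcup_(x in C) (D `&` dball d x (s x)).
  by rewrite -setI_bigcupr setIidl.
apply: outer_measure_null_countable => // x Cx.
have [c [sx c0 foo outer dens]] := hs x (CD _ Cx).
apply: (vitali_null dd mB k1 c0).
- by apply: le_lt_trans foo; apply: le_outer_measure; exact: subIsetr.
- by apply: outer; exact: subIsetr.
- move=> y [Dy xy] t t0; have [a [r [? ? ? ? aD]]] := dens y Dy xy t t0.
  exists a, r; split => //; rewrite -subset0 -aD => z [az [Dz _]].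
  by split.
Qed.

(** * Open approximation for Borel regular measures on metric spaces *)

Lemma is_dist_mdist (R : realType) (X : metricType R) : is_dist (@mdist R X).
Proof.
by split; [exact: mdistxx|exact: metric_sym|move=> *; exact: metric_triangle].
Qed.

Lemma open_dball (R : realType) (X : metricType R) (x : X) (r : R) :
  open (dball (@mdist R X) x r).
Proof.
rewrite openE => y; rewrite /dball /= => xy.
apply/nbhs_ballP; exists (r - mdist x y); first by rewrite /= subr_gt0.
move=> z; rewrite ballEmdist /= => yz.
by have := metric_triangle x y z; lra.
Qed.

Lemma caratheodory_open (R : realType) (X : metricType R)
    (mu : {outer_measure set X -> \bar R}) (U : set X) :
  borel_regular mu -> open U -> mu.-caratheodory U.
Proof. by move=> [+ _] oU; apply; exact: sub_sigma_algebra. Qed.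

(** Continuity from above, borrowed from the measure on [caratheodory_type]; a point of [T] makes
    the type pointed, and an empty [T] is treated apart. *)
Lemma caratheodory_nonincreasing (R : realType) (T : Type)
    (mu : {outer_measure set T -> \bar R}) (G : nat -> set T) (e : R) :
  (forall n, mu.-caratheodory (G n)) -> (mu (G 0%N) < +oo)%E ->
  (forall n, G n.+1 `<=` G n) -> \bigcap_n G n = set0 -> 0 < e ->
  exists n, (mu (G n) <= e%:E)%E.
Proof.
move=> mG G0 decG capG e0.
have [[x _]|T0] := pselect (exists x : T, True); last first.
  exists 0%N; suff -> : G 0%N = set0 by rewrite outer_measure0 lee_fin ltW.
  by rewrite -subset0 => x _; apply: T0; exists x.
pose P : pointedType := HB.pack {classic T} (isPointed.Build {classic T} x).
pose nu : {outer_measure set P -> \bar R} := mu.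
have : (nu \o G) n @[n --> \oo] --> nu (\bigcap_n G n).
  apply: (@nonincreasing_cvg_mu _ (caratheodory_type nu) R nu).
  - exact: G0.
  - exact: mG.
  - by rewrite capG; exact: measurable0.
  - by apply/nonincreasing_seqP => n; apply/subsetPset; exact: decG.
rewrite capG outer_measure0 => /fine_cvgP[fG /cvgrPdist_le /(_ _ e0)] dG.
have [n _ /(_ n (leqnn n)) [fn dn]] : \forall n \near \oo,
    mu (G n) \is a fin_num /\ `|0 - fine (mu (G n))| <= e.
  by near=> n; split; near: n.
exists n; rewrite -(fineK fn) lee_fin; move: dn; rewrite sub0r normrN.
by apply: le_trans; exact: ler_norm.
Unshelve. all: by end_near.
Qed.

(* The sets A approximated from outside, together with their complements,
   inside B form a sigma-algebra containing the open sets. *)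
Lemma borel_open_approx (R : realType) (X : metricType R)
    (mu : {outer_measure set X -> \bar R}) (B A : set X) :
  borel_regular mu -> open B -> (mu B < +oo)%E -> <<s open >> A ->
  forall e : R, 0 < e -> exists U V, [/\ open U, open V, A `<=` U, ~` A `<=` V &
    (mu (U `&` V `&` B) <= e%:E)%E].
Proof.
move=> reg oB Boo.
have mO := caratheodory_open reg.
pose good := [set A : set X | forall e : R, 0 < e -> exists U V,
  [/\ open U, open V, A `<=` U, ~` A `<=` V & (mu (U `&` V `&` B) <= e%:E)%E]].
suff H : <<s open>> `<=` good by move=> /H.
clear A.
apply: smallest_sub; first split; rewrite /good /=.
- move=> e e0; exists set0, setT; split => //; [exact: open0|exact: openT|].
  by rewrite !set0I outer_measure0 lee_fin ltW.
- move=> A hA e e0; have [U [V [oU oV AU AV le]]] := hA _ e0.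
  exists V, U; split => //; first by rewrite setTD.
    by rewrite setTD setCK.
  by rewrite (setIC V).
- move=> A hA e e0.
  have ek0 k : 0 < (e / 2) / (2 ^ k.+1)%:R.
    by rewrite !divr_gt0// ltr0n expn_gt0.
  pose W k := projT1 (cid (hA k _ (ek0 k))).
  have hW k : exists V, [/\ open (W k), open V, A k `<=` W k, ~` A k `<=` V &
      (mu (W k `&` V `&` B) <= ((e / 2) / (2 ^ k.+1)%:R)%:E)%E].
    exact: (projT2 (cid (hA k _ (ek0 k)))).
  pose V k := projT1 (cid (hW k)).
  have hV k : [/\ open (W k), open (V k), A k `<=` W k, ~` A k `<=` V k &
      (mu (W k `&` V k `&` B) <= ((e / 2) / (2 ^ k.+1)%:R)%:E)%E].
    exact: (projT2 (cid (hW k))).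
  have oW k : open (W k) by case: (hV k).
  have oV k : open (V k) by case: (hV k).
  pose U := \bigcup_k W k.
  have oU : open U by exact: bigcup_open.
  pose Vn n := \bigcap_(k in `I_n) V k.
  have oVn n : open (Vn n).
    rewrite /Vn; elim: n => [|n IH]; first by rewrite II0 bigcap_set0; exact: openT.
    by rewrite IIS bigcap_setU bigcap_set1; exact: openI.
  (* The intersection of all [V k] need not be open, so it is cut at [n]; the excess [G n] decreases
     to the empty set within the finite mass of [B]. *)
  pose G n := B `&` U `&` Vn n `&` ~` \bigcap_k V k.
  have mcap : mu.-caratheodory (~` \bigcap_k V k).
    rewrite setC_bigcap; apply: caratheodory_measurable_bigcup => k.
    exact/caratheodory_measurable_setC/mO.
  have mG n : mu.-caratheodory (G n).
    apply: caratheodory_measurable_setI => //; apply: mO.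
    by apply: openI => //; exact: openI.
  have e20 : 0 < e / 2 by rewrite divr_gt0.
  have [||| |N hN] := @caratheodory_nonincreasing _ _ mu G (e / 2) mG.
  + by apply: le_lt_trans Boo; apply: le_outer_measure => x [[[]]].
  + move=> n x [[BU Vx] nV]; split => //; split => // k kn.
    by apply: Vx; exact: ltn_trans kn _.
  + rewrite -subset0 => x Gx; have [_ nV] := Gx 0%N Logic.I.
    apply: nV => k _; have [[_ Vx] _] := Gx k.+1 Logic.I.
    exact: Vx (ltnSn k).
  + exact: e20.
  exists U, (Vn N); split => //.
  + by move=> x [k _ Ak]; exists k => //; case: (hV k) => _ _ + _ _; apply.
  + move=> x nA k _; case: (hV k) => _ _ _ + _; apply => Ak.
    by apply: nA; exists k.
  apply: (@le_trans _ _ (mu (G N `|` \bigcup_k (W k `&` V k `&` B)))).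
    apply: le_outer_measure => x [[[k _ Wk] Vx] Bx].
    have [aV|nV] := pselect ((\bigcap_k V k) x); last first.
      by left; split => //; split => //; split => //; exists k.
    by right; exists k => //; split => //; split => //; exact: aV.
  rewrite (splitr e) EFinD; apply: le_trans (outer_measureU2 _ _ _) _.
  apply: leeD => //; apply: le_trans (outer_measure_sigma_subadditive mu _) _.
  apply: le_trans (epsilon_trick0 xpredT (ltW e20)).
    apply: lee_nneseries => [k _ _|k _]; first exact: outer_measure_ge0.
    by case: (hV k).
- move=> A oA e e0.
  (* The closed complement of [A] is the intersection of its open neighbourhoods of radius
     [1/(n+1)], so their traces on [A] shrink to the empty set. *)
  pose V n := \bigcup_(y in ~` A) dball (@mdist R X) y n.+1%:R^-1.
  have oV n : open (V n) by apply: bigcup_open => y _; exact: open_dball.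
  pose G n := A `&` V n `&` B.
  have [|||||n hn] := @caratheodory_nonincreasing R X mu G e.
  + by move=> n; apply: mO; apply: openI => //; exact: openI.
  + by apply: le_lt_trans Boo; apply: le_outer_measure => x [].
  + move=> n x [[Ax [y Ay yx]] Bx]; split => //; split => //; exists y => //.
    move: yx; rewrite /dball /= => /lt_le_trans; apply.
    by rewrite lef_pV2 ?posrE ?ltr0n// ler_nat.
  + rewrite -subset0 => x Gx; have [[Ax _] _] := Gx 0%N Logic.I.
    move: (oA); rewrite openE => /(_ _ Ax) /nbhs_ballP[r r0 rA].
    have [m _ /(_ m (leqnn m)) hm] := near_infty_natSinv_lt (PosNum r0).
    have [[_ [y Ay yx]] _] := Gx m Logic.I.
    apply: Ay; apply: rA; rewrite ballEmdist /= metric_sym.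
    exact: lt_trans yx hm.
  + exact: e0.
  exists A, (V n); split => // y Ay; exists y => //.
  by rewrite /dball /= mdistxx invr_gt0 ltr0n.
Qed.

(** A Borel hull of [D] with the same measure is approximated by an open [U]; what [U] adds to the
    hull inside [B] lies in the small overlap of [U] and [V]. *)
Lemma borel_regular_open_superset (R : realType) (X : metricType R)
    (mu : {outer_measure set X -> \bar R}) (B D : set X) (e : R) :
  borel_regular mu -> open B -> (mu B < +oo)%E -> D `<=` B -> 0 < e ->
  exists U, [/\ open U, D `<=` U, U `<=` B & (mu U <= mu D + e%:E)%E].
Proof.
move=> reg oB Boo DB e0.
have [A [bA DA muA]] := reg.2 D.
have [U [V [oU oV AU AV le]]] := borel_open_approx reg oB Boo bA e0.
exists (U `&` B); split; first exact: openI.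
- by move=> x Dx; split; [exact/AU/DA|exact: DB].
- exact: subIsetr.
rewrite -muA (reg.1 _ bA (U `&` B)); apply: leeD.
  by apply: le_outer_measure; exact: subIsetr.
apply: le_trans le; apply: le_outer_measure => x [[Ux Bx] nA].
by split => //; split => //; exact: AV.
Qed.

(** * Volumes of boxes under countable covers *)

Lemma weighted_cover_le (R : realType) (T : Type)
    (mu : {outer_measure set T -> \bar R}) (c : \bar R) (a : nat -> \bar R)
    (E : set T) (F : nat -> set T) :
  (0 <= c)%E -> (forall k, 0 <= a k)%E ->
  mu.-caratheodory E -> (forall k, mu.-caratheodory (F k)) ->
  (forall x, c * (\1_E x)%:E <= \sum_(0 <= k <oo) a k * (\1_(F k) x)%:E)%E ->
  (c * mu E <= \sum_(0 <= k <oo) a k * mu (F k))%E.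
Proof.
move=> c0 a0 mE mF cE.
have [[x _]|T0] := pselect (exists x : T, True); last first.
  suff -> : E = set0.
    rewrite outer_measure0 mule0; apply: nneseries_ge0 => k _ _.
    by rewrite mule_ge0 ?outer_measure_ge0.
  by rewrite -subset0 => x _; apply: T0; exists x.
(* With a point chosen, [caratheodory_type] is a measurable space, and the claim is [cE] integrated,
   with monotone convergence on the right-hand side. *)
pose P : pointedType := HB.pack {classic T} (isPointed.Build {classic T} x).
pose nu : {outer_measure set P -> \bar R} := mu.
pose Y := caratheodory_type nu.
pose nm : {measure set Y -> \bar R} := nu.
have mEY : measurable (E : set Y) by exact: mE.
have mFY k : measurable (F k : set Y) by exact: mF.
have m1 (A : set Y) : measurable A ->
    measurable_fun setT (fun x : Y => (\1_A x)%:E : \bar R).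
  by move=> mA; apply/measurable_EFinP; exact: measurable_indic.
have i1 (b : \bar R) (A : set Y) : (0 <= b)%E -> measurable A ->
    (\int[nm]_(x in [set: Y]) (b * (\1_A x)%:E) = b * nm A)%E.
  move=> b0 mA; rewrite ge0_integralZl//; last exact: m1.
  by rewrite integral_indic// setIT.
have mM (b : \bar R) (A : set Y) : (0 <= b)%E -> measurable A ->
    measurable_fun setT (fun x : Y => b * (\1_A x)%:E)%E.
  by move=> b0 mA; apply: measurable_funeM; exact: m1.
have -> : (c * mu E = \int[nm]_(x in [set: Y]) (c * (\1_E x)%:E))%E by rewrite i1.
have -> : (\sum_(0 <= k <oo) a k * mu (F k) =
    \int[nm]_(x in [set: Y]) \sum_(0 <= k <oo) (a k * (\1_(F k) x)%:E))%E.
  rewrite integral_nneseries//.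
  - by apply: eq_eseriesr => k _; rewrite i1.
  - by move=> k; exact: mM.
  - by move=> k y _; rewrite mule_ge0// lee_fin.
apply: ge0_le_integral => //.
- by move=> y _; rewrite mule_ge0// lee_fin.
- exact: mM.
- apply: ge0_emeasurable_sum => [k y _ _|k _]; last exact: mM.
  by rewrite mule_ge0// lee_fin.
Qed.

Definition box (R : realType) (n : nat) (X : 'I_n -> metricType R)
  (F : forall i, set (X i)) : set (forall i, X i) := [set x | forall i, F i (x i)].

Definition measurable_sides (R : realType) (n : nat) (X : 'I_n -> metricType R)
  (mu : forall i, {outer_measure set (X i) -> \bar R})
  (F : forall i, set (X i)) : Prop := forall i, (mu i).-caratheodory (F i).

(* The integral of the indicator of [box F] over the coordinates in J. *)
Definition partial_volume (R : realType) (n : nat) (X : 'I_n -> metricType R)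
    (mu : forall i, {outer_measure set (X i) -> \bar R})
    (J : {set 'I_n}) (F : forall i, set (X i)) (x : forall i, X i) : \bar R :=
  (\prod_(i < n) (if i \in J then mu i (F i) else (\1_(F i) (x i))%:E))%E.

Section product_measure.
Context (R : realType) (n : nat) (X : 'I_n -> metricType R).
Context (mu : forall i, {outer_measure set (X i) -> \bar R}).
Local Open Scope ereal_scope.

(** With the other coordinates frozen, each partial volume is a constant times the indicator of the
    side [j], so [weighted_cover_le] integrates the inequality in that coordinate. *)
Lemma partial_volume_step (J : {set 'I_n}) (j : 'I_n) (E : forall i, set (X i))
    (F : nat -> forall i, set (X i)) :
  j \notin J -> measurable_sides mu E -> (forall k, measurable_sides mu (F k)) ->
  (forall x, partial_volume mu J E x <=
    \sum_(0 <= k <oo) partial_volume mu J (F k) x) ->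
  (forall x, partial_volume mu (j |: J) E x <=
    \sum_(0 <= k <oo) partial_volume mu (j |: J) (F k) x).
Proof.
move=> jJ mE mF leJ x.
pose g (G : forall i, set (X i)) : \bar R := \prod_(i < n | i != j)
   (if i \in J then mu i (G i) else (\1_(G i) (x i))%:E).
have g0 G : 0 <= g G.
  by apply: prode_ge0 => i _; case: ifP => _; rewrite ?outer_measure_ge0// lee_fin.
have pJ G t : partial_volume mu J G (dfwith x j t) = g G * (\1_(G j) t)%:E.
  rewrite /partial_volume (bigD1 j)//= (negbTE jJ) dfwithin muleC; congr (_ * _).
  by apply: eq_bigr => i ij; rewrite dfwithout// eq_sym.
have pjJ G : partial_volume mu (j |: J) G x = g G * mu j (G j).
  rewrite /partial_volume (bigD1 j)//= setU11 muleC; congr (_ * _).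
  by apply: eq_bigr => i ij; rewrite in_setU1 (negbTE ij).
rewrite pjJ; under eq_eseriesr do rewrite pjJ.
apply: weighted_cover_le => // [k|t]; first exact: mF.
rewrite -pJ; apply: le_trans (leJ _) _.
by under eq_eseriesr do rewrite pJ.
Qed.

(* Integrating an inequality between indicators of boxes one coordinate at a
   time turns it into an inequality between volumes. *)
Lemma partial_volume_le (J : {set 'I_n}) (E : forall i, set (X i))
    (F : nat -> forall i, set (X i)) (x0 : forall i, X i) :
  measurable_sides mu E -> (forall k, measurable_sides mu (F k)) ->
  (forall x, partial_volume mu J E x <=
    \sum_(0 <= k <oo) partial_volume mu J (F k) x) ->
  \prod_(i < n) mu i (E i) <= \sum_(0 <= k <oo) \prod_(i < n) mu i (F k i).
Proof.
(* Induction on a bound for the number of coordinates still to be integrated. *)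
move=> mE mF; move: {2}#|~: J| (leqnn #|~: J|) => m.
elim: m J => [|m IH] J.
  rewrite leqn0 cards_eq0 => /eqP J0 /(_ x0).
  have JT i : i \in J by rewrite -[J]finset.setCK J0 finset.in_setC inE.
  have pT G : partial_volume mu J G x0 = \prod_(i < n) mu i (G i).
    by apply: eq_bigr => i _; rewrite JT.
  by rewrite pT; under eq_eseriesr do rewrite pT.
have [J0|[j jJ]] := set_0Vmem (~: J).
  by move=> _; apply: IH; rewrite J0 cards0.
move=> Jm le; apply: (IH (j |: J)).
  have := cardsD1 j (~: J); rewrite jJ add1n => e.
  have -> : ~: (j |: J) = (~: J) :\ j.
    by apply/setP => i; rewrite !inE negb_or.
  by rewrite -ltnS -e.
by apply: partial_volume_step => //; move: jJ; rewrite inE.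
Qed.

Lemma prode_indic (E : forall i, set (X i)) (x : forall i, X i) :
  \prod_(i < n) (\1_(E i) (x i))%:E = (\1_(box E) x)%:E :> \bar R.
Proof.
have [xE|xE] := pselect (box E x).
  rewrite (indicE _ (box E)) mem_set// big1// => i _.
  by rewrite indicE mem_set//; exact: xE.
rewrite (indicE _ (box E)) memNset//.
have [i nE] : exists i, ~ E i (x i) by apply/existsNP.
by rewrite (bigD1 i)//= indicE memNset// mul0e.
Qed.

(** Before any integration the partial volumes are indicators of boxes, and the inequality between
    them expresses the covering. After all integrations they are constants, evaluated at [x0]. *)
Lemma le_box_cover (E : forall i, set (X i)) (F : nat -> forall i, set (X i))
    (x0 : forall i, X i) :
  measurable_sides mu E -> (forall k, measurable_sides mu (F k)) ->
  box E `<=` \bigcup_k box (F k) ->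
  \prod_(i < n) mu i (E i) <= \sum_(0 <= k <oo) \prod_(i < n) mu i (F k i).
Proof.
move=> mE mF EF; apply: (@partial_volume_le finset.set0 _ _ x0) => // x.
have p0 G : partial_volume mu finset.set0 G x = (\1_(box G) x)%:E.
  by rewrite -prode_indic; apply: eq_bigr => i _; rewrite finset.in_set0.
rewrite p0; under eq_eseriesr do rewrite p0.
have pos k : 0 <= (\1_(box (F k)) x)%:E :> \bar R by rewrite lee_fin.
have [xE|xE] := pselect (box E x); last first.
  by rewrite indicE memNset//; exact: nneseries_ge0.
have [k _ xF] := EF _ xE.
apply: le_trans (nneseries_lim_ge k.+1 _); last by [].
rewrite big_nat_recr//= indicE mem_set// indicE mem_set//.
by rewrite leeDr// sume_ge0.
Qed.

Lemma prod_measure_ge0 A : 0 <= prod_measure mu A.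
Proof.
apply: le_ereal_inf_tmp => _ [F _ <-]; apply: nneseries_ge0 => k _ _.
by apply: prode_ge0 => i _; exact: outer_measure_ge0.
Qed.
End product_measure.

(** * The product outer measure and its measurable boxes *)

Lemma nneseries_pairs (R : realType) (a : nat -> nat -> \bar R)
    (f : {bij [set: nat] >-> [set: nat * nat]}) :
  (forall i j, 0 <= a i j)%E ->
  (\sum_(0 <= k <oo) a (f k).1 (f k).2 =
   \sum_(0 <= i <oo) \sum_(0 <= j <oo) a i j)%E.
Proof.
move=> a0; rewrite nneseries_esumT//.
rewrite -(@reindex_esum _ _ _ setT setT f (fun p => a p.1 p.2)) //.
rewrite nneseries_esumT; last by move=> i; exact: nneseries_ge0.
under [RHS]eq_esum do rewrite nneseries_esumT//.
rewrite esum_esum//; congr esum.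
by apply/seteqP; split=> [[i j]|[i j]].
Qed.

Lemma prode_lty (R : realType) (n : nat) (f : 'I_n -> \bar R) :
  (forall i, 0 <= f i < +oo)%E -> (\prod_(i < n) f i < +oo)%E.
Proof.
move=> f0; rewrite -ge0_fin_numE; last first.
  by apply: prode_ge0 => i _; case/andP: (f0 i).
by apply: prode_fin_num => i _; case/andP: (f0 i) => ? ?; rewrite ge0_fin_numE.
Qed.

Lemma le_prode (R : realType) (n : nat) (f g : 'I_n -> \bar R) :
  (forall i, 0 <= f i)%E -> (forall i, f i <= g i)%E ->
  (\prod_(i < n) f i <= \prod_(i < n) g i)%E.
Proof.
move=> f0 fg; suff /andP[] : (0 <= \prod_(i < n) f i <= \prod_(i < n) g i)%E by [].
elim/big_rec2 : _ => [|i x y _ /andP[x0 xy]]; first by rewrite lee01 lexx.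
by rewrite mule_ge0//= lee_pmul.
Qed.

Lemma prode_gt0_fin (R : realType) (n : nat) (f : 'I_n -> \bar R) :
  (forall i, 0 < f i)%E -> (\prod_(i < n) f i < +oo)%E ->
  forall i, (f i < +oo)%E.
Proof.
move=> f0 fin i; rewrite ltey; apply/eqP => fi.
move: fin; rewrite (bigD1 i)//= fi gt0_mulye ?ltxx//.
by elim/big_rec : _ => [|j x _ x0]; [exact: lte01|exact: mule_gt0].
Qed.

Section product_outer_measure.
Context (R : realType) (n : nat) (X : 'I_n.+1 -> metricType R).
Context (mu : forall i, {outer_measure set (X i) -> \bar R}).
Local Open Scope ereal_scope.

Lemma volume_ge0 (F : forall i, set (X i)) : 0 <= \prod_(i < n.+1) mu i (F i).
Proof. by apply: prode_ge0 => i _; exact: outer_measure_ge0. Qed.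

Lemma prod_measure0 : prod_measure mu set0 = 0.
Proof.
apply/eqP; rewrite eq_le prod_measure_ge0 andbT; apply: ereal_inf_lbound.
exists (fun _ _ => set0).
  by split => // k i; exact: caratheodory_measurable_set0.
(* One empty side annihilates a volume because there is at least one factor; with none, the empty
   product would be 1. *)
by rewrite eseries0// => k _ _; rewrite big_ord_recl outer_measure0 mul0e.
Qed.

Lemma prod_measure_cover (A : set (forall i, X i)) (e : R) : (0 < e)%R ->
  prod_measure mu A < +oo ->
  exists F : nat -> forall i, set (X i), [/\ forall k, measurable_sides mu (F k),
    A `<=` \bigcup_k box (F k) &
    \sum_(0 <= k <oo) \prod_(i < n.+1) mu i (F k i) <= prod_measure mu A + e%:E].
Proof.
move=> e0 Aoo; have fA : prod_measure mu A \is a fin_num.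
  by rewrite ge0_fin_numE// prod_measure_ge0.
have [_ [F [mF AF] <-] /ltW le] := lb_ereal_inf_adherent e0 fA.
by exists F.
Qed.

Lemma prod_measure_subset_subadditive (A : set (forall i, X i))
    (F : nat -> set (forall i, X i)) :
  subset_sigma_subadditive (prod_measure mu) A F.
Proof.
move=> AF.
have [[i ioo]|] := pselect (exists i, prod_measure mu (F i) = +oo).
  rewrite (eseries_pinfty _ _ ioo) ?leey// => m _.
  by rewrite -ltNye (lt_le_trans _ (prod_measure_ge0 _ _)).
rewrite -forallNE => Foo; apply/lee_addgt0Pr => e e0.
apply: le_trans (epsilon_trick _ _ (ltW e0)); last first.
  by move=> m; exact: prod_measure_ge0.
have ek0 k : (0 < e / (2 ^ k.+1)%:R)%R by rewrite divr_gt0// ltr0n expn_gt0.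
have Flt k : prod_measure mu (F k) < +oo by rewrite ltey; apply/eqP/Foo.
have [G PG] := choice (fun k => prod_measure_cover (ek0 k) (Flt k)).
have /card_esym/ppcard_eqP[f] := card_nat2.
apply: (@le_trans _ _
    (\sum_(0 <= i <oo) \sum_(0 <= j <oo) \prod_(l < n.+1) mu l (G i j l))).
  rewrite -(nneseries_pairs f); last by move=> i j; exact: volume_ge0.
  apply: ereal_inf_lbound; exists (fun k => G (f k).1 (f k).2) => //.
  split; first by move=> k; case: (PG (f k).1) => + _ _; exact.
  move=> x /AF[i _ Fx]; have [_ /(_ _ Fx)[j _ Gx] _] := PG i.
  have [k _ fk] : (f @` setT) (i, j) by rewrite image_eq.
  by exists k => //=; rewrite fk.
apply: lee_nneseries => [i _ _|i _]; last by case: (PG i).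
by apply: nneseries_ge0 => j _ _; exact: volume_ge0.
Qed.

HB.instance Definition _ := isSubsetOuterMeasure.Build R (forall i, X i)
  (prod_measure mu) prod_measure0 (@prod_measure_ge0 _ _ _ mu)
  prod_measure_subset_subadditive.

Lemma prod_measure_box_le (F : forall i, set (X i)) : measurable_sides mu F ->
  prod_measure mu (box F) <= \prod_(i < n.+1) mu i (F i).
Proof.
move=> mF; apply: ereal_inf_lbound.
exists (fun k i => if k is 0%N then F i else set0).
  split; last by move=> x Fx; exists 0%N.
  by move=> [|k] i; [exact: mF|exact: caratheodory_measurable_set0].
rewrite nneseries_recl//; last by move=> k _; exact: volume_ge0.
rewrite eseries_cond/= eseries0 ?adde0// => -[|k]//= _ _.
by rewrite big_ord_recl outer_measure0 mul0e.
Qed.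

Lemma prod_measure_box (F : forall i, set (X i)) : measurable_sides mu F ->
  (exists x : forall i, X i, True) ->
  prod_measure mu (box F) = \prod_(i < n.+1) mu i (F i).
Proof.
move=> mF [x0 _]; apply/eqP; rewrite eq_le prod_measure_box_le//=.
apply: le_ereal_inf_tmp => _ [G [mG FG] <-].
exact: (@le_box_cover _ _ _ _ _ _ x0).
Qed.

(** Cutting the side [j] of every box of a cover of [A] along [E] gives covers of both parts of [A],
    and the two volumes add up because [E] is measurable for [mu j]. *)
Lemma caratheodory_cylinder (j : 'I_n.+1) (E : set (X j)) :
  (mu j).-caratheodory E ->
  (prod_measure mu).-caratheodory [set x : forall i, X i | E (x j)].
Proof.
move=> mE; apply: le_caratheodory_measurable => A.
apply: le_ereal_inf_tmp => _ [F [mF AF] <-].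
pose G (E' : set (X j)) k : forall i, set (X i) := dfwith (F k) j (F k j `&` E').
have volG E' k : \prod_(i < n.+1) mu i (G E' k i) =
    mu j (F k j `&` E') * \prod_(i < n.+1 | i != j) mu i (F k i).
  rewrite (bigD1 j)//= /G dfwithin; congr (_ * _).
  by apply: eq_bigr => i ij; rewrite dfwithout// eq_sym.
have mG E' k : (mu j).-caratheodory E' -> measurable_sides mu (G E' k).
  move=> mE' i; rewrite /G; case: dfwithP => [|i' _]; last exact: mF.
  exact: caratheodory_measurable_setI.
have subG (E' : set (X j)) : (mu j).-caratheodory E' ->
    prod_measure mu (A `&` [set x | E' (x j)]) <=
    \sum_(0 <= k <oo) \prod_(i < n.+1) mu i (G E' k i).
  move=> mE'; apply: ereal_inf_lbound; exists (G E') => //; split.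
    by move=> k; exact: mG.
  move=> x [Ax Ex]; have [k _ Fx] := AF _ Ax; exists k => // i.
  by rewrite /G; case: dfwithP => [|i' _]; [split|exact: Fx].
apply: le_trans (leeD (subG _ mE) (subG _ (caratheodory_measurable_setC mE))) _.
rewrite -nneseriesD; [|by move=> *; exact: volume_ge0..].
apply: lee_nneseries => [k _ _|k _]; first by rewrite adde_ge0// volume_ge0.
rewrite !volG -ge0_muleDl ?outer_measure_ge0// -mE.
by rewrite [leRHS](bigD1 j).
Qed.

Lemma caratheodory_box (F : forall i, set (X i)) : measurable_sides mu F ->
  (prod_measure mu).-caratheodory (box F).
Proof.
move=> mF; suff H (s : seq 'I_n.+1) : (prod_measure mu).-caratheodory
    [set x : forall i, X i | forall i, i \in s -> F i (x i)].
  have -> : box F = [set x | forall i, i \in enum 'I_n.+1 -> F i (x i)].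
    apply/seteqP; split=> [x Fx i _|x Fx i]; first exact: Fx.
    by apply: Fx; rewrite mem_enum.
  exact: H.
elim: s => [|j s IH].
  rewrite (_ : [set _ | _] = setT); last by apply/seteqP; split.
  rewrite -setC0; apply: caratheodory_measurable_setC.
  exact: caratheodory_measurable_set0.
rewrite (_ : [set _ | _] = [set x : forall i, X i | F j (x j)] `&`
    [set x : forall i, X i | forall i, i \in s -> F i (x i)]).
  by apply: caratheodory_measurable_setI => //; exact: caratheodory_cylinder.
apply/seteqP; split=> [x Fx|x [Fj Fs] i].
  by split=> [|i is_]; apply: Fx; rewrite inE ?eqxx// is_ orbT.
by rewrite inE => /orP[/eqP->//|/Fs].
Qed.
End product_outer_measure.

(** * The maximum distance and the product measure *)

Lemma is_dist_dist_max (R : realType) (n : nat) (X : 'I_n -> metricType R) :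
  is_dist (@dist_max R n X).
Proof.
split=> [x|x y|x y z]; rewrite /dist_max.
- by apply: big1_idem => [|i _]; [exact: maxxx|exact: mdistxx].
- by apply: eq_bigr => i _; exact: metric_sym.
- apply: bigmax_le => [|i _].
    by apply: addr_ge0; exact: bigmax_ge_id.
  apply: le_trans (metric_triangle _ (y i) _) _.
  by apply: lerD; apply: le_bigmax.
Qed.

Lemma dball_dist_max (R : realType) (n : nat) (X : 'I_n -> metricType R)
    (x : forall i, X i) (r : R) : 0 < r ->
  dball (@dist_max R n X) x r = rect x (fun=> r).
Proof.
move=> r0; apply/seteqP; split=> [y /bigmax_ltP[_ xy] i|y xy]; first exact: xy.
by apply/bigmax_ltP; split => // i _; exact: xy.
Qed.

Lemma rectE (R : realType) (n : nat) (X : 'I_n -> metricType R)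
    (x : forall i, X i) (r : 'I_n -> R) :
  rect x r = box (fun i => dball (@mdist R (X i)) (x i) (r i)).
Proof. by []. Qed.

Lemma open_setC_msupp (R : realType) (X : metricType R)
    (mu : {outer_measure set X -> \bar R}) : open (~` msupp (@mdist R X) mu).
Proof.
rewrite openE => x /existsNP[r /not_implyP[r0 /negP]].
rewrite -leNgt => xr0.
apply/nbhs_ballP; exists (r / 2); first by rewrite /= divr_gt0.
move=> y; rewrite ballEmdist /= => xy /(_ (r / 2)).
rewrite divr_gt0// => /(_ isT); apply/negP; rewrite -leNgt.
apply: le_trans xr0; apply: le_outer_measure => z; rewrite /dball /= => yz.
by have := metric_triangle x y z; lra.
Qed.

(** The product is a polynomial in [s], hence continuous at 0. *)
Lemma prod_perturb (R : realType) (n : nat) (a : 'I_n -> R) (e : R) : 0 < e ->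
  exists2 s, 0 < s & \prod_(i < n) (a i + s) <= \prod_(i < n) a i + e.
Proof.
move=> e0; pose p : {poly R} := \prod_(i < n) ((a i)%:P + 'X).
have pE s : p.[s] = \prod_(i < n) (a i + s).
  by rewrite horner_prod; apply: eq_bigr => i _; rewrite !hornerE.
have /cvgrPdist_le /(_ _ e0) /nbhs_ballP[r r0 rp] := @continuous_horner R p 0.
exists (r / 2); first by rewrite divr_gt0.
have : ball 0 r (r / 2).
  rewrite /ball /= sub0r normrN gtr0_norm ?divr_gt0//.
  by have : 0 < r := r0; lra.
move=> /rp /=; rewrite !pE ler_norml => /andP[+ _].
under [in X in _ <= X - _ -> _]eq_bigr do rewrite addr0.
lra.
Qed.

Section product_metric.
Context (R : realType) (n : nat) (X : 'I_n.+1 -> metricType R).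
Context (mu : forall i, {outer_measure set (X i) -> \bar R}).
Context (reg : forall i, borel_regular (mu i)).
Local Open Scope ereal_scope.

Lemma measurable_sides_open (F : forall i, set (X i)) :
  (forall i, open (F i)) -> measurable_sides mu F.
Proof. by move=> oF i; exact: caratheodory_open. Qed.

Lemma caratheodory_rect (x : forall i, X i) (r : 'I_n.+1 -> R) :
  (prod_measure mu).-caratheodory (rect x r).
Proof.
rewrite rectE; apply: caratheodory_box; apply: measurable_sides_open => i.
exact: open_dball.
Qed.

Lemma caratheodory_dball_max (x : forall i, X i) (r : R) :
  (prod_measure mu).-caratheodory (dball (@dist_max R n.+1 X) x r).
Proof.
have [r0|r0] := ltP 0%R r.
  by rewrite dball_dist_max//; exact: caratheodory_rect.
suff -> : dball (@dist_max R n.+1 X) x r = set0.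
  exact: caratheodory_measurable_set0.
rewrite -subset0 => y; rewrite /dball /= => /lt_le_trans /(_ r0).
by rewrite ltNge is_dist_ge0//; exact: is_dist_dist_max.
Qed.

Lemma prod_measure_rect (x : forall i, X i) (r : 'I_n.+1 -> R) :
  prod_measure mu (rect x r) =
  \prod_(i < n.+1) mu i (dball (@mdist R (X i)) (x i) (r i)).
Proof.
apply: prod_measure_box; last by exists x.
by apply: measurable_sides_open => i; exact: open_dball.
Qed.

Lemma msupp_prod :
  msupp (@dist_max R n.+1 X) (prod_measure mu) =
  box (fun i => msupp (@mdist R (X i)) (mu i)).
Proof.
apply/seteqP; split=> [x xs i r r0|x xs r r0].
  have := xs r r0; rewrite dball_dist_max// prod_measure_rect => p0.
  rewrite lt0e outer_measure_ge0 andbT; apply/eqP => i0.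
  by move: p0; rewrite (bigD1 i)//= i0 mul0e ltxx.
rewrite dball_dist_max// prod_measure_rect.
elim/big_rec : _ => [|i y _ y0]; first exact: lte01.
by apply: mule_gt0 => //; exact: xs.
Qed.

Lemma caratheodory_msupp_prod :
  (prod_measure mu).-caratheodory (msupp (@dist_max R n.+1 X) (prod_measure mu)).
Proof.
rewrite msupp_prod; apply: caratheodory_box => i.
rewrite -[msupp _ _]setCK; apply: caratheodory_measurable_setC.
exact/caratheodory_open/open_setC_msupp.
Qed.

(** In a nearly optimal cover of [D] by boxes, the sides are cut down to [B], where they have finite
    mass, and then enlarged to open sets, each side of a box by the same [s], so small that the
    volumes grow by a summable error. *)
Lemma outer_approx_prod_measure (B : forall i, set (X i))
    (D : set (forall i, X i)) :
  (forall i, open (B i)) -> (forall i, mu i (B i) < +oo) -> D `<=` box B ->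
  outer_approx (@dist_max R n.+1 X) (prod_measure mu) D.
Proof.
move=> oB Boo DB e e0.
have Doo : prod_measure mu D < +oo.
  apply: le_lt_trans (le_outer_measure (prod_measure mu) _ _ DB) _.
  apply: le_lt_trans (prod_measure_box_le (measurable_sides_open oB)) _.
  by apply: prode_lty => i; rewrite outer_measure_ge0 Boo.
have e20 : (0 < e / 2)%R by rewrite divr_gt0.
have [F [mF DF leF]] := prod_measure_cover e20 Doo.
have hG k : exists G : forall i, set (X i), [/\ forall i, open (G i),
    forall i, F k i `&` B i `<=` G i &
    \prod_(i < n.+1) mu i (G i) <=
    \prod_(i < n.+1) mu i (F k i) + (e / 2 / (2 ^ k.+1)%:R)%:E].
  have ek0 : (0 < e / 2 / (2 ^ k.+1)%:R)%R by rewrite divr_gt0// ltr0n expn_gt0.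
  have foo i : mu i (F k i `&` B i) < +oo.
    by apply: le_lt_trans (Boo i); apply: le_outer_measure; exact: subIsetr.
  have ff i : mu i (F k i `&` B i) \is a fin_num.
    by rewrite ge0_fin_numE ?outer_measure_ge0.
  have [s s0 hs] := prod_perturb (fun i => fine (mu i (F k i `&` B i))) ek0.
  have h i : exists U, [/\ open U, F k i `&` B i `<=` U, U `<=` B i &
      mu i U <= mu i (F k i `&` B i) + s%:E].
    by apply: borel_regular_open_superset => //; exact: subIsetr.
  exists (fun i => projT1 (cid (h i))); split.
  - by move=> i; case: cid => U /= [].
  - by move=> i; case: cid => U /= [].
  apply: (@le_trans _ _ (\prod_(i < n.+1) (mu i (F k i `&` B i) + s%:E))).
    apply: le_prode => i; first exact: outer_measure_ge0.
    by case: cid => U /= [].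
  have -> : \prod_(i < n.+1) (mu i (F k i `&` B i) + s%:E) =
      (\prod_(i < n.+1) (fine (mu i (F k i `&` B i)) + s))%:E.
    by rewrite -prodEFin; apply: eq_bigr => i _; rewrite EFinD fineK.
  apply: (@le_trans _ _ (\prod_(i < n.+1) mu i (F k i `&` B i)
      + (e / 2 / (2 ^ k.+1)%:R)%:E)).
    under [in leRHS]eq_bigr do rewrite -(fineK (ff _)).
    by rewrite prodEFin -EFinD lee_fin.
  apply: leeD => //; apply: le_prode => i; first exact: outer_measure_ge0.
  by apply: le_outer_measure; exact: subIsetl.
have [G {}hG] := choice hG.
have oG k : forall i, open (G k i) by case: (hG k).
have FG k : forall i, F k i `&` B i `<=` G k i by case: (hG k).
exists (\bigcup_k box (G k)); split.
- move=> x Dx; have [k _ Fx] := DF _ Dx; exists k => // i.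
  by apply: FG; split; [exact: Fx|exact: DB].
- move=> x Dx; have [k _ Fx] := DF _ Dx.
  have Gx i : G k i (x i) by apply: FG; split; [exact: Fx|exact: DB].
  have hs i : exists2 s : R, (0 < s)%R & dball (@mdist R (X i)) (x i) s `<=` G k i.
    have := oG k i; rewrite openE => /(_ _ (Gx i)) /nbhs_ballP[s s0 sG].
    by exists s => // y; move: (sG y); rewrite ballEmdist.
  pose s i := projT1 (cid2 (hs i)).
  have s0 i : (0 < s i)%R by rewrite /s; case: cid2.
  have sG i : dball (@mdist R (X i)) (x i) (s i) `<=` G k i.
    by rewrite /s; case: cid2.
  exists (\big[Num.min/1%R]_(i < n.+1) s i).
    by apply: lt_bigmin => // i _; exact: s0.
  move=> y xy; exists k => // i; apply: sG; move: xy; rewrite /dball /=.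
  move=> /(le_lt_trans (le_bigmax 0%R (fun i => mdist (x i) (y i)) i)).
  by move=> /lt_le_trans; apply; exact: bigmin_le.
apply: le_trans (outer_measure_sigma_subadditive (prod_measure mu) _) _.
apply: (@le_trans _ _ (\sum_(0 <= k <oo) (\prod_(i < n.+1) mu i (F k i)
    + (e / 2 / (2 ^ k.+1)%:R)%:E))).
  apply: lee_nneseries => [k _ _|k _]; first exact: prod_measure_ge0.
  apply: le_trans (prod_measure_box_le (measurable_sides_open (oG k))) _.
  by case: (hG k).
apply: le_trans (epsilon_trick _ _ (ltW e20)) _.
  by move=> k; exact: volume_ge0.
by rewrite [in leRHS](splitr e) EFinD addeA leeD2r.
Qed.

End product_metric.

(** * Sigma-finiteness of the product and null slices *)

Section product_sigma_finite.
Context (R : realType) (n : nat) (X : 'I_n.+1 -> metricType R).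
Context (mu : forall i, {outer_measure set (X i) -> \bar R}).
Context (sf : forall i, sigma_finite_outer (mu i)).
Local Open Scope ereal_scope.

Lemma sigma_finite_boxes : exists G : nat -> forall i, set (X i),
  [/\ [set: forall i, X i] = \bigcup_m box (G m),
      forall m, measurable_sides mu (G m) & forall m i, mu i (G m i) < +oo].
Proof.
pose F i := projT1 (cid2 (sf i)).
have FT i : [set: X i] = \bigcup_k F i k by rewrite /F; case: cid2.
have mF i k : (mu i).-caratheodory (F i k).
  by rewrite /F; case: cid2 => ? _ /= /(_ k)[].
have Foo i k : mu i (F i k) < +oo by rewrite /F; case: cid2 => ? _ /= /(_ k)[].
(* A natural number codes a choice of one piece in each factor; numbers that code nothing give the
   empty box. *)
exists (fun m i => if unpickle m is Some g then F i ((g : {ffun 'I_n.+1 -> nat}) i)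
                   else set0).
split.
- apply/seteqP; split=> // x _.
  have hk i : exists k, F i k (x i).
    by have : [set: X i] (x i) by []; rewrite FT => -[k _ Fx]; exists k.
  pose g : {ffun 'I_n.+1 -> nat} := [ffun i => projT1 (cid (hk i))].
  exists (pickle g) => // i; rewrite pickleK ffunE.
  exact: (projT2 (cid (hk i))).
- move=> m i; case: unpickle => [g|]; first exact: mF.
  exact: caratheodory_measurable_set0.
- by move=> m i; case: unpickle => [g|]; [exact: Foo|rewrite outer_measure0].
Qed.

Lemma sigma_finite_prod_measure : sigma_finite_outer (prod_measure mu).
Proof.
have [G [GT mG Goo]] := sigma_finite_boxes.
exists (fun m => box (G m)) => // m; split; first exact: caratheodory_box.
apply: le_lt_trans (prod_measure_box_le (mG m)) _.
by apply: prode_lty => i; rewrite outer_measure_ge0 Goo.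
Qed.

(* The complement of D in a box has full slices in direction j, so every cover
   of it by boxes has at least the volume of the whole box. *)
Lemma slices_null (j : 'I_n.+1) (D : set (forall i, X i)) :
  (prod_measure mu).-caratheodory D ->
  (forall x, mu j [set t | D (dfwith x j t)] = 0) ->
  prod_measure mu D = 0.
Proof.
move=> mD D0; have [G [GT mG Goo]] := sigma_finite_boxes.
rewrite -[D]setIT GT setI_bigcupr; apply: outer_measure_null_bigcup => m.
have [->|/set0P[x0 _]] := eqVneq (D `&` box (G m)) set0.
  exact: outer_measure0.
have Gfin : \prod_(i < n.+1) mu i (G m i) < +oo.
  by apply: prode_lty => i; rewrite outer_measure_ge0 Goo.
have boxfin : prod_measure mu (box (G m)) < +oo.
  exact: le_lt_trans (prod_measure_box_le (mG m)) _.
have finI A : prod_measure mu (box (G m) `&` A) \is a fin_num.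
  rewrite ge0_fin_numE ?prod_measure_ge0//; apply: le_lt_trans boxfin.
  by apply: (le_outer_measure (prod_measure mu)); exact: subIsetl.
(* As all masses are finite, the mass of the complement can be cancelled in the Caratheodory
   splitting of the box along [D]. *)
suff : prod_measure mu (box (G m)) <= prod_measure mu (box (G m) `&` ~` D).
  rewrite (mD (box (G m))) -[leRHS]add0e leeD2rE ?finI// => le0.
  by apply/eqP; rewrite eq_le outer_measure_ge0 andbT setIC.
apply/lee_addgt0Pr => e e0.
have Mfin : prod_measure mu (box (G m) `&` ~` D) < +oo.
  by rewrite -ge0_fin_numE ?finI ?prod_measure_ge0.
have [F [mF MF leF]] := prod_measure_cover e0 Mfin.
apply: le_trans leF; rewrite (prod_measure_box (mG m)); last by exists x0.
(* Starting with coordinate [j] already integrated, the inequality to prove concerns the line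
   through [x] in direction [j]. *)
apply: (@partial_volume_le _ _ _ _ [set j]%SET _ _ x0) => // x.
pose g (H : forall i, set (X i)) := forall i, i != j -> H i (x i).
have pE H : partial_volume mu [set j]%SET H x =
    if pselect (g H) then mu j (H j) else 0.
  rewrite /partial_volume (bigD1 j)//= finset.in_set1 eqxx.
  case: pselect => /= [gH|gH].
    rewrite big1 ?mule1// => i ij.
    by rewrite finset.in_set1 (negbTE ij) indicE mem_set//; exact: gH.
  have /existsNP[i /not_implyP[ij nH]] := gH.
  rewrite (bigD1 i)//= finset.in_set1 (negbTE ij) indicE memNset//.
  by rewrite mul0e mule0.
have p0 H : 0 <= partial_volume mu [set j]%SET H x.
  by rewrite pE; case: ifP => _ //; exact: outer_measure_ge0.
rewrite pE; case: ifP => [|_]; last exact: nneseries_ge0.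
case: pselect => //= gG _.
(* On that line the box is covered by the null slice of [D] and by the [j]-th sides of those [F k]
   whose other sides contain the coordinates of [x]. *)
apply: (@le_trans _ _ (mu j ([set t | D (dfwith x j t)] `|`
   \bigcup_k (if pselect (g (F k)) then F k j else set0)))).
  apply: le_outer_measure => t Gt.
  have [Dt|Dt] := pselect (D (dfwith x j t)); [by left|right].
  have [|k _ Ft] := MF (dfwith x j t).
    split=> // i; case: dfwithP => // i' ij.
    by apply: gG; rewrite eq_sym.
  exists k => //; case: pselect => /= [_|gF].
    by have := Ft j; rewrite dfwithin.
  by exfalso; apply: gF => i ij; have := Ft i; rewrite dfwithout// eq_sym.
apply: le_trans (outer_measureU2 _ _ _) _; rewrite D0 add0e.
apply: le_trans (outer_measure_sigma_subadditive (mu j) _) _.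
apply: lee_nneseries => [k _ _|k _]; first exact: outer_measure_ge0.
by rewrite pE; case: ifP => // _; rewrite outer_measure0.
Qed.

End product_sigma_finite.

(** * Measurability of limsup sets on the support *)

Section limsup_sets.
Context (R : realType) (n : nat) (X : 'I_n.+1 -> metricType R).
Context (mu : forall i, {outer_measure set (X i) -> \bar R}).
Context (reg : forall i, borel_regular (mu i)).
Context (sf : forall i, sigma_finite_outer (mu i)).
Context (Rs : nat -> set (forall i, X i)).
Let supp := msupp (@dist_max R n.+1 X) (prod_measure mu).
Local Notation M := (prod_measure mu).-caratheodory.

(* The support is Lindelof, so on it a union of arbitrarily many rectangles is
   a union of countably many balls. *)
Lemma caratheodory_Delta_supp (psi : 'I_n.+1 -> nat -> R) (a : nat) :
  M (supp `&` Delta Rs psi a).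
Proof.
have hs (x : forall i, X i) : exists s, 0 < s /\
    (Delta Rs psi a x -> dball (@dist_max R n.+1 X) x s `<=` Delta Rs psi a).
  have [[b Rb bx]|nx] := pselect (Delta Rs psi a x); last by exists 1; split.
  exists (\big[Num.min/1]_(i < n.+1) (psi i a - mdist (b i) (x i))); split.
    by apply: lt_bigmin => // i _; rewrite subr_gt0; exact: bx.
  move=> _ y xy; exists b => // i; move: xy; rewrite /dball /= => xy.
  have h1 : mdist (x i) (y i) <= dist_max x y.
    exact: (le_bigmax 0 (fun i => mdist (x i) (y i)) i).
  have h2 : \big[Num.min/1]_(i < n.+1) (psi i a - mdist (b i) (x i)) <=
      psi i a - mdist (b i) (x i) by exact: bigmin_le.
  by have := metric_triangle (b i) (x i) (y i); lra.
have [s {}hs] := choice hs.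
have [C [cC CA AC]] := @lindelof_msupp _ _ _ (prod_measure mu)
  (supp `&` Delta Rs psi a) s (is_dist_dist_max X)
  (caratheodory_dball_max reg) (sigma_finite_prod_measure sf)
  (@subIsetl _ _ _) (fun x _ => (hs x).1).
have -> : supp `&` Delta Rs psi a =
    supp `&` \bigcup_(x in C) dball (@dist_max R n.+1 X) x (s x).
  apply/seteqP; split=> x [sx Dx]; split => //; first by apply: AC.
  by move: Dx => [y Cy]; apply: (hs y).2; exact: (CA y Cy).2.
apply: caratheodory_measurable_setI; first exact: caratheodory_msupp_prod.
have /countable_injP[f finj] := cC.
rewrite (bigcup_fiber _ f); apply: caratheodory_measurable_bigcup => k.
have [[i Ci ->]| ->] := fiber_set1_or_set0 k finj.
  by rewrite bigcup_set1; exact: caratheodory_dball_max.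
by rewrite bigcup_set0; exact: caratheodory_measurable_set0.
Qed.

(** This supplies the measurability that [slices_null] requires: the limsup and the tail union
    become countable combinations of the traces of the [Delta] sets on the support. *)
Lemma caratheodory_limsup_supp (psi psi' : 'I_n.+1 -> nat -> R) (l : nat) :
  M (supp `&` Wset Rs psi `\` \bigcup_(a >= l) Delta Rs psi' a).
Proof.
have -> : supp `&` Wset Rs psi `\` \bigcup_(a >= l) Delta Rs psi' a =
    (\bigcap_m \bigcup_k (supp `&` Delta Rs psi (m + k)%N)) `\`
    \bigcup_k (supp `&` Delta Rs psi' (l + k)%N).
  apply/seteqP; split=> [x [[sx Wx] Dx]|x [Wx Dx]].
    split=> [m _|[k _ [_ Dk]]].
      have [a /= ma Da] := Wx m Logic.I.
      by exists (a - m)%N => //; rewrite subnKC.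
    by apply: Dx; exists (l + k)%N => //=; exact: leq_addr.
  have [k0 _ [sx _]] := Wx 0%N Logic.I.
  split; first split=> // m _.
    by have [k _ [_ Dk]] := Wx m Logic.I; exists (m + k)%N => //=; exact: leq_addr.
  move=> [a /= la Da]; apply: Dx; exists (a - l)%N => //; split => //.
  by rewrite subnKC.
apply: caratheodory_measurable_setD; last first.
  by apply: caratheodory_measurable_bigcup => k; exact: caratheodory_Delta_supp.
rewrite -[\bigcap_m _]setCK setC_bigcap; apply: caratheodory_measurable_setC.
apply: caratheodory_measurable_bigcup => m; apply: caratheodory_measurable_setC.
by apply: caratheodory_measurable_bigcup => k; exact: caratheodory_Delta_supp.
Qed.
End limsup_sets.

(** * Null exceptional sets, under the ball comparison and under doubling *)

Section zero_measure.
Context (R : realType) (n : nat) (X : 'I_n.+1 -> metricType R).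
Context (mu : forall i, {outer_measure set (X i) -> \bar R}).
Context (reg : forall i, borel_regular (mu i)).
Context (sf : forall i, sigma_finite_outer (mu i)).
Context (lf : locally_finite_measure (@dist_max R n.+1 X) (prod_measure mu)).
Context (Rs : nat -> set (forall i, X i)).
Local Notation d := (@dist_max R n.+1 X).
Local Notation supp := (msupp d (prod_measure mu)).

(** At a point of the support every factor ball has positive mass, so a finite product forces all
    its factors to be finite. *)
Lemma finite_factors (x : forall i, X i) : supp x -> exists s : R,
  [/\ 0 < s, (prod_measure mu (dball d x s) < +oo)%E &
      forall i, (mu i (dball (@mdist R (X i)) (x i) s) < +oo)%E].
Proof.
move=> sx; have [s s0 fin] := lf x; exists s; split => // i.
move: fin; rewrite dball_dist_max// prod_measure_rect// => /prode_gt0_fin; apply.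
by move=> k; move: sx; rewrite msupp_prod// => /(_ k); exact.
Qed.

Definition vanishing (psi : 'I_n.+1 -> nat -> R) : Prop :=
  forall e : R, 0 < e -> exists N, forall a, (N <= a)%N -> forall i, psi i a < e.

Lemma Wset_often (psi : 'I_n.+1 -> nat -> R) (x : forall i, X i) (N : nat) (e : R) :
  vanishing psi -> Wset Rs psi x -> 0 < e ->
  exists a b, [/\ (N <= a)%N, forall i, psi i a < e, Rs a b & rect b (psi^~ a) x].
Proof.
move=> psi0 Wx e0; have [N' hN'] := psi0 _ e0.
have [a /= Na [b Rb bx]] := Wx (maxn N N') Logic.I.
exists a, b; split => //; first exact: leq_trans (leq_maxl _ _) Na.
by apply: hN'; exact: leq_trans (leq_maxr _ _) Na.
Qed.

(** Such a point is a limit of centres in the support, which is closed. *)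
Lemma Wset_sub_msupp (psi : 'I_n.+1 -> nat -> R) : vanishing psi ->
  (forall a, Rs a `<=` supp) -> Wset Rs psi `<=` supp.
Proof.
move=> psi0 Rsupp x Wx r r0; have r20 : 0 < r / 2 by rewrite divr_gt0.
have [a [b [_ small Rb bx]]] := Wset_often 0 psi0 Wx r20.
apply: lt_le_trans (Rsupp _ _ Rb _ r20) _.
apply: (le_outer_measure (prod_measure mu)) => y.
have [_ dsym dtri] := is_dist_dist_max X.
have : dball d b (r / 2) x.
  by rewrite dball_dist_max// => i; exact: lt_trans (bx i) (small i).
rewrite /dball /= => bx' yb.
by have := dtri x b y; rewrite (dsym x b); lra.
Qed.

(** With equal sides the rectangles are balls for the maximum distance, and [vitali_null_local]
    applies in the product itself. *)
Lemma null_balls (phi : nat -> R) (k : R) (l : nat) :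
  0 < k -> k <= 1 -> vanishing (fun=> phi) ->
  (exists2 c : R, 0 < c & \forall a \near \oo, forall x, Rs a x ->
     (c%:E * prod_measure mu (rect x (fun=> (5 * phi a)%R)) <=
      prod_measure mu (rect x (fun=> (k * phi a)%R)))%E) ->
  prod_measure mu (supp `&` Wset Rs (fun=> phi) `\`
    \bigcup_(a >= l) Delta Rs (fun _ a => k * phi a) a) = 0%E.
Proof.
move=> k0 k1 phi0 [c c0 [N _ hN]].
have dd := is_dist_dist_max X; have [_ dsym dtri] := dd.
apply: (@vitali_null_local _ _ d (prod_measure mu) _ k dd
  (caratheodory_dball_max reg) (sigma_finite_prod_measure sf) k1).
  by move=> x [[]].
move=> x [[sx _] _]; have [s [s0 fin fins]] := finite_factors sx.
exists s, c; split => //.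
  move=> A As.
  apply: (@outer_approx_prod_measure _ _ _ _ reg
    (fun i => dball (@mdist R (X i)) (x i) s)) => //.
    by move=> i; exact: open_dball.
  by apply: subset_trans As _; rewrite dball_dist_max.
move=> y [[sy Wy] nDy] _ t t0.
(* Beyond [l] the shrunken balls avoid the set; beyond [N] the mass comparison holds. *)
have [a [b [la /(_ ord0) small Rb bxy]]] := Wset_often (maxn l N) phi0 Wy t0.
have r0 : 0 < phi a by exact: le_lt_trans (mdist_ge0 _ _) (bxy ord0).
have kr0 : 0 < k * phi a by exact: mulr_gt0.
have r50 : 0 < 5 * phi a by exact: mulr_gt0.
have by_ : dball d b (phi a) y by rewrite dball_dist_max.
have le : (c%:E * prod_measure mu (dball d b (5 * phi a)) <=
    prod_measure mu (dball d b (k * phi a)))%E.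
  rewrite !dball_dist_max//; apply: hN => //=.
  exact: leq_trans (leq_maxr _ _) la.
exists b, (phi a); split => //.
(* The mass is positive because the fivefold ball contains a ball centred at [y], a point of the
   support. *)
- apply: lt_le_trans le; apply: mule_gt0; first by rewrite lte_fin.
  apply: lt_le_trans (sy _ r0) _.
  apply: (le_outer_measure (prod_measure mu)) => z.
  move: by_; rewrite /dball /= => by_ yz.
  by have := dtri b y z; lra.
- rewrite -subset0 => z [bz [_ nDz]]; apply: nDz; exists a => /=.
    exact: leq_trans (leq_maxl _ _) la.
  by exists b => //; move: bz; rewrite dball_dist_max.
Qed.

(** Doubling is applied at the point with [j]-th coordinate [t] and the others from [x]. The mass of
    its ball is that of the side [j] times the product [Q] of the others; since [Q r <= Q (2 * r)],
    the positive [Q (2 * r)] cancels, being finite by [2 * r <= s]. *)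
Lemma factor_doubling (lam r0 s : R) (x : forall i, X i) (j : 'I_n.+1) (r : R) :
  (forall z r, supp z -> 0 < r -> r < r0 ->
    (prod_measure mu (dball d z (2 * r)) <=
     lam%:E * prod_measure mu (dball d z r))%E) ->
  0 < lam -> supp x ->
  (forall i, (mu i (dball (@mdist R (X i)) (x i) s) < +oo)%E) ->
  0 < r -> r < r0 -> 2 * r <= s ->
  forall t, msupp (@mdist R (X j)) (mu j) t ->
  (mu j (dball (@mdist R (X j)) t (2 * r)) <=
   lam%:E * mu j (dball (@mdist R (X j)) t r))%E.
Proof.
move=> dbl lam0 sx fin r_gt0 rr0 rs t st.
have sx' : forall i, msupp (@mdist R (X i)) (mu i) (x i).
  by move: sx; rewrite msupp_prod.
have r2 : 0 < 2 * r by rewrite mulr_gt0.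
pose Q u := (\prod_(i < n.+1 | i != j) mu i (dball (@mdist R (X i)) (x i) u))%E.
have Qpos u : 0 < u -> (0 < Q u)%E.
  move=> u0; rewrite /Q; elim/big_rec : _ => [|i y _ y0]; first exact: lte01.
  by apply: mule_gt0 => //; exact: sx'.
have Qfin : Q (2 * r) \is a fin_num.
  apply: prode_fin_num => i _; rewrite ge0_fin_numE ?outer_measure_ge0//.
  apply: le_lt_trans (fin i); apply: le_outer_measure => y.
  by rewrite /dball /= => /lt_le_trans; apply.
have QE u : 0 < u -> prod_measure mu (dball d (dfwith x j t) u) =
    (mu j (dball (@mdist R (X j)) t u) * Q u)%E.
  move=> u0; rewrite dball_dist_max// prod_measure_rect// (bigD1 j)//= dfwithin.
  by congr (_ * _)%E; apply: eq_bigr => i ij; rewrite dfwithout// eq_sym.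
have sz : supp (dfwith x j t).
  by rewrite msupp_prod// => i; case: dfwithP.
have := dbl _ _ sz r_gt0 rr0; rewrite !QE// muleA => h.
rewrite -(@lee_pmul2r _ (Q (2 * r)%R))//; last exact: Qpos.
apply: le_trans h _; apply: lee_wpmul2l.
  by rewrite mule_ge0 ?outer_measure_ge0// lee_fin ltW.
suff /andP[] : (0 <= Q r <= Q (2 * r)%R)%E by [].
rewrite /Q; elim/big_rec2 : _ => [|i y z _ /andP[y0 yz]].
  by rewrite lee01 lexx.
rewrite mule_ge0 ?outer_measure_ge0//=; apply: lee_pmul => //.
  exact: outer_measure_ge0.
apply: le_outer_measure => w; rewrite /dball /= => /lt_le_trans; apply.
by lra.
Qed.

Lemma factor_doubling_iter (lam r0 s : R) (x : forall i, X i) (j : 'I_n.+1)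
    (r : R) (m : nat) :
  (forall z r, supp z -> 0 < r -> r < r0 ->
    (prod_measure mu (dball d z (2 * r)) <=
     lam%:E * prod_measure mu (dball d z r))%E) ->
  0 < lam -> supp x ->
  (forall i, (mu i (dball (@mdist R (X i)) (x i) s) < +oo)%E) ->
  0 < r -> 2 ^+ m * r <= r0 -> 2 ^+ m * r <= s ->
  forall t, msupp (@mdist R (X j)) (mu j) t ->
  (mu j (dball (@mdist R (X j)) t (2 ^+ m * r)) <=
   (lam ^+ m)%:E * mu j (dball (@mdist R (X j)) t r))%E.
Proof.
move=> dbl lam0 sx fin r_gt0 + + t st; elim: m => [|m IH].
  by rewrite !expr0 mul1r mul1e.
rewrite !exprS -!mulrA => h1 h2.
have p0 : 0 < 2 ^+ m * r by rewrite mulr_gt0// exprn_gt0.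
apply: le_trans (factor_doubling dbl lam0 sx fin p0 _ h2 st) _; first by lra.
rewrite EFinM -muleA; apply: lee_wpmul2l; first by rewrite lee_fin ltW.
by apply: IH; lra.
Qed.

(** On a line in direction [j], a point of the slice lies near the coordinate [b j] of a centre. A
    point of the slice in the shrunken ball around [b j] would share the other coordinates, hence
    lie in the forbidden [Delta]: the slice misses that ball. *)
Lemma null_one_side (psi : 'I_n.+1 -> nat -> R) (j : 'I_n.+1) (k : R) (l : nat) :
  0 < k -> k <= 1 -> vanishing psi ->
  doubling d (prod_measure mu) -> (forall a, Rs a `<=` supp) ->
  prod_measure mu (supp `&` Wset Rs psi `\` \bigcup_(a >= l)
    Delta Rs (fun i a => if i == j then k * psi i a else psi i a) a) = 0%E.
Proof.
move=> k0 k1 psi0 [lam [r0 [lam0 r00 dbl]]] Rsupp.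
apply: (slices_null sf (j := j)); first exact: caratheodory_limsup_supp.
set D := _ `\` _ => x.
apply: (@vitali_null_local _ _ (@mdist R (X j)) (mu j) _ k (is_dist_mdist (X j)) _
  (sf j) k1).
- by move=> t r; apply: caratheodory_open => //; exact: open_dball.
- by move=> t [[]]; rewrite msupp_prod// => /(_ j); rewrite dfwithin.
move=> t [[sy _] _]; have [s [s0 _ fin]] := finite_factors sy.
(* [m] doublings carry the radius [k * r] to at least [5 * r], because [2 ^ m > m > 5 / k]. *)
pose m := (Num.truncn (5 / k)).+1.
have km : 5 <= 2 ^+ m * k.
  rewrite -ler_pdivrMr//; apply: le_trans (ltW (truncnS_gt _)) _.
  by rewrite -natrX ler_nat ltnW// ltn_expl.
have pm : 0 < 2 ^+ m :> R by rewrite exprn_gt0.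
exists s, (lam ^+ m)^-1; split => //.
- by rewrite invr_gt0 exprn_gt0.
- by have := fin j; rewrite dfwithin.
- move=> A As e e0; have fj := fin j; rewrite dfwithin in fj.
  have [U [oU AU _ Ue]] := borel_regular_open_superset (reg j)
    (@open_dball _ _ t s) fj As e0.
  exists U; split => // y /AU Uy; move: oU; rewrite openE => /(_ _ Uy).
  move=> /nbhs_ballP[u u0 uU]; exists u => // z.
  by move: (uU z); rewrite ballEmdist.
move=> t' [[sy' Wy'] nDy'] _ e e0.
(* The bound keeps the dilated radii within both the range of doubling and the radius [s] of finite
   mass. *)
have e'0 : 0 < Num.min e (Num.min s r0 / 2 ^+ m).
  by rewrite lt_min e0 divr_gt0// lt_min s0.
have [a [b [la small Rb bt]]] := Wset_often l psi0 Wy' e'0.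
have r_gt0 : 0 < psi j a by exact: le_lt_trans (mdist_ge0 _ _) (bt j).
have kr0 : 0 < k * psi j a by exact: mulr_gt0.
have := small j; rewrite lt_min ltr_pdivlMr// lt_min => /andP[re /andP[rs rr0]].
have kr : 2 ^+ m * (k * psi j a) <= psi j a * 2 ^+ m.
  by rewrite mulrC ler_pM2r// ler_piMl// ltW.
have sb : msupp (@mdist R (X j)) (mu j) (b j).
  by have := Rsupp _ _ Rb; rewrite msupp_prod.
exists (b j), (psi j a); split => //.
- by have := bt j; rewrite dfwithin.
- exact: sb.
- rewrite lee_pdivrMl ?exprn_gt0//.
  apply: le_trans
    (factor_doubling_iter (s := s) (m := m) dbl lam0 sy fin kr0 _ _ sb).
  + apply: le_outer_measure => z; rewrite /dball /= => /lt_le_trans; apply.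
    by rewrite mulrA ler_pM2r.
  + by lra.
  + by lra.
- rewrite -subset0 => u [bu [_ nDu]]; apply: nDu; exists a => //.
  exists b => // i; case: dfwithP => [|i' ij]; first by rewrite eqxx.
  by rewrite eq_sym (negbTE ij); have := bt i'; rewrite dfwithout.
Qed.

End zero_measure.

(** * Decomposition of the badly approximable set *)

Lemma notin_Wset (R : realType) (n : nat) (X : 'I_n -> metricType R)
    (Rs : nat -> set (forall i, X i)) (psi : 'I_n -> nat -> R) (x : forall i, X i) :
  ~ Wset Rs psi x -> exists l, ~ (\bigcup_(a >= l) Delta Rs psi a) x.
Proof. by move=> /existsNP[l /not_implyP[_ nx]]; exists l. Qed.

Lemma vanishing_cvg0 (R : realType) (n : nat) (phi : 'I_n.+1 -> nat -> R) :
  (forall i, phi i a @[a --> \oo] --> (0 : R)) -> vanishing phi.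
Proof.
move=> phi0 e e0.
have : \forall a \near \oo, forall i, phi i a < e.
  apply: filter_forall => i; have /cvgrPdist_lt /(_ _ e0) := phi0 i.
  apply: filterS => a; rewrite sub0r normrN.
  by apply: le_lt_trans; exact: ler_norm.
by move=> [N _ hN]; exists N.
Qed.

(** [psi m] shrinks the sides of index below [m], so it runs from [phi] to [k * phi]; membership is
    lost at some step, where only the side [j] shrinks. *)
Lemma Wset_scaled_prefix (R : realType) (n : nat) (X : 'I_n.+1 -> metricType R)
    (Rs : nat -> set (forall i, X i)) (phi : 'I_n.+1 -> nat -> R) (k : R)
    (x : forall i, X i) :
  let psi m (i : 'I_n.+1) a := if (i < m)%N then k * phi i a else phi i a in
  Wset Rs phi x -> ~ Wset Rs (fun i a => k * phi i a) x ->
  exists j : 'I_n.+1, Wset Rs (psi j) x /\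
    ~ Wset Rs (fun i a => if i == j then k * psi j i a else psi j i a) x.
Proof.
move=> psi Wx nWx; apply: contrapT => nj; apply: nWx.
suff H m : (m <= n.+1)%N -> Wset Rs (psi m) x.
  have <- : psi n.+1 = (fun i a => k * phi i a).
    by apply/funext => i; apply/funext => a; rewrite /psi ltn_ord.
  exact: H.
elim: m => [_|m IH mn]; first exact: Wx.
apply: contrapT => nW; apply: nj; exists (Ordinal mn); split.
  by apply: IH; exact: ltnW.
suff <- : psi m.+1 = (fun i a => if i == Ordinal mn then
    k * psi (Ordinal mn) i a else psi (Ordinal mn) i a) by [].
apply/funext => i; apply/funext => a.
rewrite /psi ltnS leq_eqVlt -val_eqE /=.
by case: (ltngtP i m).
Qed.

Theorem theorem4p1 (R : realType) (n : nat) (hn : (0 < n)%N)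
  (X : 'I_n -> metricType R)
  (mu_ : forall i, {outer_measure set (X i) -> \bar R})
  (hreg : forall i, borel_regular (mu_ i))
  (hsf : forall i, sigma_finite_outer (mu_ i))
  (hlf : locally_finite_measure (@dist_max R n X) (prod_measure mu_))
  (phi : 'I_n -> nat -> R)
  (phi_ge0 : forall i alpha, 0 <= phi i alpha)
  (phi_cvg0 : forall i, phi i alpha @[alpha --> \oo] --> (0 : R))
  (Rs : nat -> set (forall i, X i))
  (hyp :
    (doubling (@dist_max R n X) (prod_measure mu_) /\
     forall alpha, Rs alpha `<=` msupp (@dist_max R n X) (prod_measure mu_))
    \/
    [/\ forall i j, phi i = phi j,
        prod_measure mu_ (~` msupp (@dist_max R n X) (prod_measure mu_)) = 0%E &
        forall delta rho : R, 0 < delta -> delta < rho ->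
          exists2 c : R, 0 < c &
            \forall alpha \near \oo, forall x, Rs alpha x ->
              (c%:E * prod_measure mu_ (rect x (fun i => (rho * phi i alpha)%R))
               <= prod_measure mu_ (rect x (fun i => (delta * phi i alpha)%R)))%E]) :
  prod_measure mu_ (Bad Rs phi) = 0%E.
Proof.
destruct n as [|n]; first by [].
have phi0 := vanishing_cvg0 phi_cvg0.
have k0 k : 0 < k.+1%:R^-1 :> R by rewrite invr_gt0.
have k1 k : k.+1%:R^-1 <= 1 :> R by rewrite invf_le1// ler1n.
apply/eqP; rewrite eq_le prod_measure_ge0 andbT.
set supp := msupp (@dist_max R n.+1 X) (prod_measure mu_).
case: hyp => [[dbl Rsupp]|[phiE suppC dens]].
- pose psi k m (i : 'I_n.+1) a :=
    if (i < m)%N then k.+1%:R^-1 * phi i a else phi i a.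
  have psi0 k m : vanishing (psi k m).
    move=> e e0; have [N hN] := phi0 e e0; exists N => a Na i.
    apply: le_lt_trans (hN a Na i); rewrite /psi; case: ifP => // _.
    by rewrite ler_piMl.
  pose D k (j : 'I_n.+1) l := supp `&` Wset Rs (psi k j) `\` \bigcup_(a >= l)
    Delta Rs (fun i a => if i == j then k.+1%:R^-1 * psi k j i a else psi k j i a) a.
  have D0 k j l : prod_measure mu_ (D k j l) = 0%E by apply: null_one_side.
  (* [inord] lets the finite index [j] run through [nat], so that all three unions are over
     [nat]. *)
  apply: (@le_trans _ _ (prod_measure mu_
      (\bigcup_k \bigcup_m \bigcup_l D k (inord m) l))).
    apply: (le_outer_measure (prod_measure mu_)) => x [Wx /existsNP[k]].
    move=> /not_implyP[_ nWx].
    have [j [Wj nWj]] := Wset_scaled_prefix Wx nWx.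
    have [l nl] := notin_Wset nWj.
    exists k => //; exists j => //; exists l => //; rewrite inord_val.
    by split => //; split => //; exact: (Wset_sub_msupp (psi0 k j) Rsupp Wj).
  rewrite outer_measure_null_bigcup// => k.
  rewrite outer_measure_null_bigcup// => m.
  by rewrite outer_measure_null_bigcup// => l; exact: D0.
- pose D k l := supp `&` Wset Rs (fun=> phi ord0) `\`
    \bigcup_(a >= l) Delta Rs (fun _ a => k.+1%:R^-1 * phi ord0 a) a.
  have phiE0 : phi = fun=> phi ord0 by apply/funext => i; exact: phiE.
  have D0 k l : prod_measure mu_ (D k l) = 0%E.
    apply: null_balls => //; first by rewrite -phiE0.
    have [|c c0 hc] := dens k.+1%:R^-1 5 (k0 k).
      by apply: le_lt_trans (k1 k) _; rewrite ltr1n.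
    by exists c => //; move: hc; rewrite phiE0.
  (* Points off the support are absorbed by its complement, null by assumption. *)
  apply: (@le_trans _ _ (prod_measure mu_
      (~` supp `|` \bigcup_k \bigcup_l D k l))).
    apply: (le_outer_measure (prod_measure mu_)) => x [Wx /existsNP[k]].
    move=> /not_implyP[_ nWx].
    have [sx|nsx] := pselect (supp x); [right|by left].
    have [l nl] := notin_Wset nWx.
    exists k => //; exists l => //; rewrite /D -phiE0.
    by split => //; rewrite phiE0 in nl.
  apply: le_trans (outer_measureU2 _ _ _) _; rewrite [X in (X + _)%E]suppC add0e.
  rewrite outer_measure_null_bigcup// => k.
  by rewrite outer_measure_null_bigcup// => l; exact: D0.
Qed.
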